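(* For every $n\ge1$: (1) $\operatorname{ProjK}^-_{\mathbb{R}^n}\equiv_{\mathrm{W}}\operatorname{Proj}^-_{\mathbb{R}^n}$; (2) $\operatorname{ProjK}^+_{\mathbb{R}^n}\equiv_{\mathrm{sW}}\operatorname{Proj}^+_{\mathbb{R}^n}$; (3) $\operatorname{ProjK}_{\mathbb{R}^n}\equiv_{\mathrm{sW}}\operatorname{Proj}_{\mathbb{R}^n}$.
   Context: Represented spaces: a representation of a set $X$ is a partial surjection $\delta_X:\subseteq\mathbb{N}^\mathbb{N}\to X$. For a partial multi-valued function $f:\subseteq X\rightrightarrows Y$, a realizer is a partial $F:\subseteq\mathbb{N}^\mathbb{N}\to\mathbb{N}^\mathbb{N}$ with $\delta_Y(F(p))\in f(\delta_X(p))$ for all $p$ with $\delta_X(p)\in\mathrm{dom}(f)$. Weihrauch reducibility: $f\le_{\mathrm{W}} g$ iff there are computable partial $H:\subseteq\mathbb{N}^\mathbb{N}\times\mathbb{N}^\mathbb{N}\to\mathbb{N}^\mathbb{N}$ and $K:\subseteq\mathbb{N}^\mathbb{N}\to\mathbb{N}^\mathbb{N}$ such that $p\mapsto H(p,G(K(p)))$ is a realizer of $f$ for every realizer $G$ of $g$. Strong Weihrauch reducibility $f\le_{\mathrm{sW}}g$: there are computable $H,K$ with $H\circ G\circ K$ a realizer of $f$ for every realizer $G$ of $g$. $\equiv_{\mathrm{W}}$, $\equiv_{\mathrm{sW}}$ denote reducibility in both directions. $\mathbb{R}^n$ has the Euclidean metric and the Cauchy representation (names are sequences $(q_i)$ in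 $\mathbb{Q}^n$ with $d(q_i,q_j)\le2^{-i}$ for $j\ge i$, naming the limit). Basic balls are open balls $B(c,r)$ with $c\in\mathbb{Q}^n$, $r$ a nonnegative rational. Closed sets: $\mathcal{A}_-(\mathbb{R}^n)$ (negative information): a name of closed $A$ enumerates basic balls whose union is $\mathbb{R}^n\setminus A$; $\mathcal{A}_+(\mathbb{R}^n)$ (positive information): a name enumerates exactly the basic balls meeting $A$ (for nonempty $A$ equivalently, a sequence of points dense in $A$); $\mathcal{A}(\mathbb{R}^n)$ (total information): a pair of a negative and a positive name. Compact sets: $\mathcal{K}_-(\mathbb{R}^n)$, $\mathcal{K}_+(\mathbb{R}^n)$, $\mathcal{K}(\mathbb{R}^n)$ consist of compact sets $K$ named by a name of $K$ in $\mathcal{A}_-$, $\mathcal{A}_+$, $\mathcal{A}$ respectively together with a natural number $N$ such that $K\subseteq\overline{B}(0,N)$. For $x\in\mathbb{R}^n$ and nonempty closed $A$, a projection point of $x$ onto $A$ is $y\in A$ with $d(x,y)=d(x,A)=\inf_{a\in A}d(x,a)$. $\operatorname{Proj}^-_{\mathbb{R}^n}:\subseteq\mathbb{R}^n\times\mathcal{A}_-(\mathbb{R}^n)\rightrightarrows\mathbb{R}^n$, $\operatorname{Proj}^+_{\mathbb{R}^n}:\subseteq\mathbb{R}^n\times\mathcal{A}_+(\mathbb{R}^n)\rightrightarrows\mathbb{R}^n$, $\operatorname{Proj}_{\mathbb{R}^n}:\subseteq\mathbb{R}^n\times\mathcal{A}(\mathbb{R}^n)\rightrightarrows\mathbb{R}^n$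 map $(x,A)$ with $A\neq\emptyset$ closed to the set of projection points of $x$ onto $A$. $\operatorname{ProjK}^-_{\mathbb{R}^n}$, $\operatorname{ProjK}^+_{\mathbb{R}^n}$, $\operatorname{ProjK}_{\mathbb{R}^n}$ are defined the same way with $\mathcal{A}_-,\mathcal{A}_+,\mathcal{A}$ replaced by $\mathcal{K}_-,\mathcal{K}_+,\mathcal{K}$ (nonempty compact sets). *)

(* Defs.v *)
From Stdlib Require Import Reals Lra List QArith Qabs Qreals.
Import ListNotations.
Open Scope R_scope.

Definition baire := nat -> nat.

Definition evens (p : baire) : baire := fun i => p (2 * i)%nat.
Definition odds (p : baire) : baire := fun i => p (2 * i + 1)%nat.
Definition join (p q : baire) : baire :=
  fun i => if Nat.even i then p (Nat.div2 i) else q (Nat.div2 i).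
Definition btail (p : baire) : baire := fun i => p (S i).
Definition prefix (p : baire) (n : nat) : list nat := map p (seq 0 n).

Inductive prf : Type :=
| pZero
| pSucc
| pProj (i : nat)
| pComp (f : prf) (gs : list prf)
| pRec (f g : prf)
| pMu (f : prf).

Inductive prf_eval : prf -> list nat -> nat -> Prop :=
| ev_zero xs : prf_eval pZero xs 0%nat
| ev_succ x xs : prf_eval pSucc (x :: xs) (S x)
| ev_proj i xs : (i < length xs)%nat -> prf_eval (pProj i) xs (nth i xs 0%nat)
| ev_comp f gs xs ys z :
    Forall2 (fun g y => prf_eval g xs y) gs ys ->
    prf_eval f ys z -> prf_eval (pComp f gs) xs z
| ev_rec0 f g xs y : prf_eval f xs y -> prf_eval (pRec f g) (0%nat :: xs) y
| ev_recS f g n xs r y :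
    prf_eval (pRec f g) (n :: xs) r -> prf_eval g (n :: r :: xs) y ->
    prf_eval (pRec f g) (S n :: xs) y
| ev_mu f xs n :
    prf_eval f (n :: xs) 0%nat ->
    (forall m, (m < n)%nat -> exists k, prf_eval f (m :: xs) (S k)) ->
    prf_eval (pMu f) xs n.

Definition computable_nat (h : nat -> nat) : Prop :=
  exists c : prf, forall x, prf_eval c [x] (h x).

Definition npair (a b : nat) : nat := ((a + b) * (a + b + 1) / 2 + a)%nat.
Fixpoint code_list (l : list nat) : nat :=
  match l with
  | [] => 0%nat
  | a :: l' => S (npair a (code_list l'))
  end.

(* Inverse of npair (enumeration of N x N along the diagonals) *)
Fixpoint unpair (k : nat) : nat * nat :=
  match k with
  | O => (0%nat, 0%nat)
  | S k' => match unpair k' with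
            | (a, O) => (0%nat, S a)
            | (a, S b) => (S a, b)
            end
  end.

(* Computable partial functions on Baire space, via associates:
   the total computable h computes the partial map p |-> q where
   q i + 1 = h <i, p(0),...,p(m-1)> for the least m with a nonzero value.
   Every computable partial function has an extension of this form,
   and every such map is a computable partial function. *)
Definition assoc_apply (h : nat -> nat) (p q : baire) : Prop :=
  forall i, exists m,
    (forall k, (k < m)%nat -> h (code_list (i :: prefix p k)) = 0%nat) /\
    h (code_list (i :: prefix p m)) = S (q i).

Record problem : Type := Problem {
  pX : Type;
  pY : Type;
  dX : baire -> pX -> Prop;   (* dX p x : p is a name of x *)
  dY : baire -> pY -> Prop;
  pdom : pX -> Prop;
  pval : pX -> pY -> Prop
}.

(* Realizers are arbitrary partial functions on Baire space *)
Definition realizer (f : problem) (G : baire -> option baire) : Prop :=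
  forall p x, dX f p x -> pdom f x ->
    exists q, G p = Some q /\ exists y, dY f q y /\ pval f x y.

Definition weihrauch_le (f g : problem) : Prop :=
  exists hH hK : nat -> nat, computable_nat hH /\ computable_nat hK /\
  forall G, realizer g G ->
  forall p x, dX f p x -> pdom f x ->
    exists q, assoc_apply hK p q /\
    exists r, G q = Some r /\
    exists s, assoc_apply hH (join p r) s /\
    exists y, dY f s y /\ pval f x y.

Definition strong_weihrauch_le (f g : problem) : Prop :=
  exists hH hK : nat -> nat, computable_nat hH /\ computable_nat hK /\
  forall G, realizer g G ->
  forall p x, dX f p x -> pdom f x ->
    exists q, assoc_apply hK p q /\
    exists r, G q = Some r /\
    exists s, assoc_apply hH r s /\
    exists y, dY f s y /\ pval f x y.

Definition weihrauch_eq (f g : problem) : Prop :=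
  weihrauch_le f g /\ weihrauch_le g f.
Definition strong_weihrauch_eq (f g : problem) : Prop :=
  strong_weihrauch_le f g /\ strong_weihrauch_le g f.

Definition Rn (n : nat) : Type := { x : nat -> R | forall i, (n <= i)%nat -> x i = 0 }.

Lemma mkRn_prop (n : nat) (f : nat -> R) :
  forall i, (n <= i)%nat -> (if Nat.ltb i n then f i else 0) = 0.
Proof.
  intros i Hi. destruct (Nat.ltb i n) eqn:E; [|reflexivity].
  apply Nat.ltb_lt in E. exfalso. apply (Nat.lt_irrefl i).
  eapply Nat.lt_le_trans; eauto.
Qed.

Definition mkRn (n : nat) (f : nat -> R) : Rn n :=
  exist _ (fun i => if Nat.ltb i n then f i else 0) (mkRn_prop n f).

Fixpoint sumsq (n : nat) (x y : nat -> R) : R :=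
  match n with
  | O => 0
  | S m => sumsq m x y + (x m - y m) ^ 2
  end.

Definition dist {n : nat} (x y : Rn n) : R :=
  sqrt (sumsq n (proj1_sig x) (proj1_sig y)).

Definition origin (n : nat) : Rn n := mkRn n (fun _ => 0).

Definition decZ (k : nat) : Z :=
  if Nat.even k then Z.of_nat (Nat.div2 k) else (- Z.of_nat (S (Nat.div2 k)))%Z.
Definition decQ (k : nat) : Q :=
  let (a, b) := unpair k in Qmake (decZ a) (Pos.of_succ_nat b).
Fixpoint coord (k i : nat) : nat :=
  match i with
  | O => fst (unpair k)
  | S i' => coord (snd (unpair k)) i'
  end.
(* the rational vector in Q^n coded by k (every vector in Q^n has a code) *)
Definition Qvec (n k : nat) : Rn n := mkRn n (fun i => Q2R (decQ (coord k i))).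

Definition ball_center (n k : nat) : Rn n := Qvec n (fst (unpair k)).
Definition ball_radius (k : nat) : R := Q2R (Qabs (decQ (snd (unpair k)))).
Definition in_ball (n k : nat) (y : Rn n) : Prop :=
  dist (ball_center n k) y < ball_radius k.

Definition names_Rn (n : nat) (p : baire) (x : Rn n) : Prop :=
  (forall i j, (i <= j)%nat -> dist (Qvec n (p i)) (Qvec n (p j)) <= / 2 ^ i) /\
  (forall eps, eps > 0 -> exists N, forall i, (N <= i)%nat ->
       dist (Qvec n (p i)) x < eps).

Definition closed_set {n : nat} (A : Rn n -> Prop) : Prop :=
  forall x, ~ A x -> exists eps, eps > 0 /\ forall y, dist x y < eps -> ~ A y.

(* In the enumerations below, p i = 0 means "nothing", p i = S k lists ball k. *)

Definition names_neg (n : nat) (p : baire) (A : Rn n -> Prop) : Prop :=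
  forall x, ~ A x <-> exists i k, p i = S k /\ in_ball n k x.

Definition names_pos (n : nat) (p : baire) (A : Rn n -> Prop) : Prop :=
  closed_set A /\
  forall k, (exists y, A y /\ in_ball n k y) <-> exists i, p i = S k.

Definition names_tot (n : nat) (p : baire) (A : Rn n -> Prop) : Prop :=
  names_neg n (evens p) A /\ names_pos n (odds p) A.

Definition bounded_by {n : nat} (A : Rn n -> Prop) (N : nat) : Prop :=
  forall x, A x -> dist (origin n) x <= INR N.

Definition with_bound (nm : forall n : nat, baire -> (Rn n -> Prop) -> Prop)
  (n : nat) (p : baire) (A : Rn n -> Prop) : Prop :=
  nm n (btail p) A /\ bounded_by A (p 0%nat).

Definition is_proj_point {n : nat} (x : Rn n) (A : Rn n -> Prop) (y : Rn n) : Prop :=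
  A y /\
  (* d(x,y) = inf_{a in A} d(x,a) *)
  (forall a, A a -> dist x y <= dist x a) /\
  (forall r, (forall a, A a -> r <= dist x a) -> r <= dist x y).

Definition ProjProblem (nm : forall n : nat, baire -> (Rn n -> Prop) -> Prop)
  (n : nat) : problem :=
  {| pX := (Rn n * (Rn n -> Prop))%type;
     pY := Rn n;
     dX := fun p xA => names_Rn n (evens p) (fst xA) /\ nm n (odds p) (snd xA);
     dY := names_Rn n;
     pdom := fun xA => exists a, snd xA a;
     pval := fun xA y => is_proj_point (fst xA) (snd xA) y |}.

Definition Proj_neg (n : nat) := ProjProblem names_neg n.
Definition Proj_pos (n : nat) := ProjProblem names_pos n.
Definition Proj_tot (n : nat) := ProjProblem names_tot n.
Definition ProjK_neg (n : nat) := ProjProblem (with_bound names_neg) n.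
Definition ProjK_pos (n : nat) := ProjProblem (with_bound names_pos) n.
Definition ProjK_tot (n : nat) := ProjProblem (with_bound names_tot) n.

(* Main.v *)
(** In one direction the reduction forgets the bound, and the answer is passed on unchanged.

    For the converses of (2) and (3), a single listed ball gives an upper bound for d(x, A), hence an N
    with |x| + d(x, A) < N. Replace A by K = (A cap B(0, N)) cup S(0, N), S(0, N) the sphere. The sphere is
    too far from x to contribute projection points, and the other points that were cut off are even
    farther, so every projection point of x onto K is one onto A. Adding the whole sphere
    makes both kinds of information on K available: a ball meets K iff its intersection with B(0, N) meets A
    or it meets the sphere, and a point of the closed ball is outside K iff it lies in B(0, N) and outside A.

    For the converse of (1) no bound is computable. Here A is pulled back along z |-> x + psi(z), where
    psi(z) = z / (1 - |z|^2) is a radially increasing homeomorphism of the open unit ball onto R^n, and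
    the unit sphere is added. A projection point w of the origin onto this compact set lies inside the
    open ball, and x + psi(w) is a projection point of x onto A. *)

From Stdlib Require Import Reals Lra Lia List Qabs.
From Stdlib Require Import FunctionalExtensionality ProofIrrelevance ClassicalEpsilon.
Require Import Defs.
Import ListNotations.

(** * Partial recursive functions and associates *)

(** A finite part of a negative name never certifies a point of A in a given ball, so for (1) no
    search can produce a radius, whereas a positive name of a nonempty set eventually lists a ball.
    The formula for psi is chosen because it is rational in the coordinates: psi sends rational
    vectors to rational vectors, so the tests on images of rational balls are decidable, which |z|
    in place of |z|^2 would spoil. The price is that psi is not Lipschitz up to the sphere; each
    estimate carries a margin M that keeps the points within norm 1 - 1/(M+1), and M is searched
    for.

    Computability means a code in [prf]. Every reduction is therefore driven by a test decided by
    integer arithmetic, with distances compared through their squares. Codes only perform bounded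
    search; unbounded search is left to the associate, which answers 0 until the prefix is long
    enough. A bound inside a name is a single number although it is found at some stage of reading,
    so the output is tied to the least successful stage. *)

Open Scope nat_scope.

(** Environments [v] are infinite, so that variables under binders need no arity bookkeeping;
    the code only sees the first [k] entries. *)
Definition cp (f : (nat -> nat) -> nat) : Prop :=
  exists c k, forall v w, k <= length w -> (forall i, i < k -> nth i w 0 = v i) ->
    prf_eval c w (f v).

Lemma cp_ext f g : (forall v, f v = g v) -> cp f -> cp g.
Proof.
  intros E (c & k & H). exists c, k. intros v w Hl Hw. rewrite <- E. auto.
Qed.

Lemma cp_var i : cp (fun v => v i).
Proof.
  exists (pProj i), (S i). intros v w Hl Hw.
  rewrite <- (Hw i) by lia. constructor. lia.
Qed.

Lemma cp_zero : cp (fun _ => 0).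
Proof. exists pZero, 0. intros. constructor. Qed.

(** The code of [f] sees only [k] entries, so finitely many of the codes for [s] enter the
    composition, and the maximum of their arities serves for all of them. *)
Lemma cp_subst f (s : (nat -> nat) -> nat -> nat) :
  cp f -> (forall i, cp (fun v => s v i)) -> cp (fun v => f (s v)).
Proof.
  intros (c & k & H) Hs.
  assert (Hk : exists gs K, length gs = k /\ forall v w, K <= length w ->
     (forall i, i < K -> nth i w 0 = v i) ->
     Forall2 (fun g y => prf_eval g w y) gs (map (s v) (seq 0 k))).
  { clear H. induction k as [|k (gs & K & Hl & IH)].
    - exists [], 0. split; [reflexivity|]. intros. constructor.
    - destruct (Hs k) as (d & K' & Hd). exists (gs ++ [d]), (max K K').
      split. { rewrite length_app. simpl. lia. }
      intros v w Hw Hv. rewrite seq_S, map_app. apply Forall2_app.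
      + apply IH; [lia|]. intros; apply Hv; lia.
      + simpl. constructor; [|constructor]. apply Hd; [lia|]. intros; apply Hv; lia. }
  destruct Hk as (gs & K & Hl & Hg). exists (pComp c gs), K. intros v w Hw Hv.
  econstructor. { apply (Hg v w Hw Hv). }
  apply H.
  - rewrite length_map, length_seq. lia.
  - intros i Hi. rewrite (nth_indep _ 0 (s v 0)) by (rewrite length_map, length_seq; lia).
    rewrite map_nth, seq_nth by lia. reflexivity.
Qed.

Lemma cp_app1 (F : nat -> nat) a :
  cp (fun v => F (v 0)) -> cp a -> cp (fun v => F (a v)).
Proof.
  intros HF Ha.
  apply (cp_subst (fun v => F (v 0)) (fun v i => match i with 0 => a v | _ => 0 end) HF).
  intros [|i]; [exact Ha|exact cp_zero].
Qed.

Lemma cp_app2 (F : nat -> nat -> nat) a b :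
  cp (fun v => F (v 0) (v 1)) -> cp a -> cp b -> cp (fun v => F (a v) (b v)).
Proof.
  intros HF Ha Hb.
  apply (cp_subst (fun v => F (v 0) (v 1))
    (fun v i => match i with 0 => a v | 1 => b v | _ => 0 end) HF).
  intros [|[|i]]; [exact Ha|exact Hb|exact cp_zero].
Qed.

(** [pRec] runs its step on counter, accumulator and then parameters, hence the shift by two in the
    hypothesis on [s]. The parameters are handed over by [K] projections, enough for both base and
    step. *)
Lemma cp_rec b s n :
  cp b -> cp (fun w => s (w 0) (w 1) (fun i => w (S (S i)))) -> cp n ->
  cp (fun v => nat_rect (fun _ => nat) (b v) (fun i r => s i r v) (n v)).
Proof.
  intros (cb & kb & Hb) (cs & ks & Hs) (cn & kn & Hn).
  set (K := max kb ks).
  exists (pComp (pRec cb cs) (cn :: map pProj (seq 0 K))), (max kn K).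
  intros v w Hw Hv.
  apply ev_comp with (ys := n v :: map v (seq 0 K)).
  - constructor. { apply Hn; [lia|]. intros; apply Hv; lia. }
    assert (forall i, i < K -> prf_eval (pProj i) w (v i)) as HP.
    { intros i Hi. rewrite <- (Hv i) by lia. constructor. lia. }
    assert (forall l, (forall i, In i l -> i < K) ->
      Forall2 (fun g y => prf_eval g w y) (map pProj l) (map v l)) as HF.
    { induction l; intros Hl; simpl; constructor.
      - apply HP, Hl. now left.
      - apply IHl. intros; apply Hl; now right. }
    apply HF. intros i Hi. apply in_seq in Hi. lia.
  - set (u := map v (seq 0 K)).
    assert (Hu : length u = K) by (unfold u; rewrite length_map, length_seq; auto).
    assert (Hun : forall i, i < K -> nth i u 0 = v i).
    { intros i Hi. unfold u. rewrite (nth_indep _ 0 (v 0)) by (fold u; lia).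
      rewrite map_nth, seq_nth by lia. reflexivity. }
    induction (n v) as [|m IH]; simpl.
    + constructor. apply Hb; [lia|]. intros; apply Hun; lia.
    + econstructor; [exact IH|].
      match goal with |- prf_eval _ (_ :: ?r :: _) _ =>
        apply (Hs (fun j => match j with 0 => m | 1 => r | S (S j) => v j end)) end.
      * simpl. lia.
      * intros [|[|i]] Hi; simpl; auto. apply Hun. lia.
Qed.

(** The code may expect more than one entry, so the argument is padded with zeros. *)
Lemma cp_computable h : cp (fun v => h (v 0)) -> computable_nat h.
Proof.
  intros (c & k & H). exists (pComp c (pProj 0 :: repeat pZero k)). intros x.
  apply ev_comp with (ys := x :: repeat 0 k).
  - constructor. { apply (ev_proj 0 [x]). simpl. lia. }
    clear H. induction k; simpl; constructor; auto. constructor.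
  - apply (H (fun i => match i with 0 => x | _ => 0 end)).
    + simpl. rewrite repeat_length. lia.
    + intros [|i] Hi; simpl; [reflexivity|]. apply nth_repeat.
Qed.

(** * Arithmetic, comparisons and bounded search *)

Lemma cp_S a : cp a -> cp (fun v => S (a v)).
Proof.
  apply (cp_app1 S). exists pSucc, 1. intros v [|x w] Hl Hw; simpl in *; [lia|].
  rewrite <- (Hw 0) by lia. constructor.
Qed.

Lemma cp_const n : cp (fun _ => n).
Proof. induction n; [exact cp_zero|now apply cp_S]. Qed.

Definition cpb (f : (nat -> nat) -> bool) : Prop := cp (fun v => Nat.b2n (f v)).

Lemma cp_add a b : cp a -> cp b -> cp (fun v => a v + b v).
Proof.
  intros Ha Hb. eapply cp_ext; [|apply (cp_rec b (fun _ r _ => S r) a Hb); [apply cp_S, cp_var|exact Ha]].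
  intros v. simpl. induction (a v); simpl; auto.
Qed.

Lemma cp_mul a b : cp a -> cp b -> cp (fun v => a v * b v).
Proof.
  intros Ha Hb. apply (cp_app2 Nat.mul); auto.
  eapply cp_ext; [|apply (cp_rec (fun _ => 0) (fun _ r v => v 1 + r) (fun v => v 0) cp_zero);
    [apply cp_add; apply cp_var|apply cp_var]].
  intros v. simpl. induction (v 0); simpl; auto.
Qed.

Lemma cp_pow a b : cp a -> cp b -> cp (fun v => a v ^ b v).
Proof.
  intros Ha Hb. apply (cp_app2 Nat.pow); auto.
  eapply cp_ext; [|apply (cp_rec (fun _ => 1) (fun _ r v => v 0 * r) (fun v => v 1) (cp_const 1));
    [apply cp_mul; apply cp_var|apply cp_var]].
  intros v. simpl. induction (v 1); simpl; auto.
Qed.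

Lemma cp_pred a : cp a -> cp (fun v => pred (a v)).
Proof.
  apply (cp_app1 pred).
  eapply cp_ext; [|apply (cp_rec (fun _ => 0) (fun i _ _ => i) (fun v => v 0) cp_zero); apply cp_var].
  intros v. simpl. destruct (v 0); reflexivity.
Qed.

Lemma cp_sub a b : cp a -> cp b -> cp (fun v => a v - b v).
Proof.
  intros Ha Hb.
  eapply cp_ext; [|apply (cp_rec a (fun _ r _ => pred r) b Ha); [apply cp_pred, cp_var|exact Hb]].
  intros v. cbv beta. induction (b v) as [|m IH]; cbn [nat_rect]; [lia|]. rewrite IH. lia.
Qed.

Lemma cp_if b x y : cpb b -> cp x -> cp y -> cp (fun v => if b v then x v else y v).
Proof.
  intros Hb Hx Hy.
  apply cp_ext with (fun v => Nat.b2n (b v) * x v + (1 - Nat.b2n (b v)) * y v).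
  - intros v. destruct (b v); cbn [Nat.b2n]; lia.
  - apply cp_add; apply cp_mul; auto. apply cp_sub; auto. apply cp_const.
Qed.

Lemma cpb_ext f g : (forall v, f v = g v) -> cpb f -> cpb g.
Proof. intros E. apply cp_ext. intros v. now rewrite E. Qed.

Lemma cpb_leb a b : cp a -> cp b -> cpb (fun v => a v <=? b v).
Proof.
  intros Ha Hb. apply cp_ext with (fun v => 1 - (a v - b v)).
  - intros v. destruct (Nat.leb_spec (a v) (b v)); cbn [Nat.b2n]; lia.
  - apply cp_sub; [apply cp_const|]. now apply cp_sub.
Qed.

Lemma cpb_negb f : cpb f -> cpb (fun v => negb (f v)).
Proof.
  intros H. apply cp_ext with (fun v => 1 - Nat.b2n (f v)).
  - intros v. destruct (f v); reflexivity.
  - apply cp_sub; [apply cp_const|exact H].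
Qed.

Lemma cpb_andb f g : cpb f -> cpb g -> cpb (fun v => f v && g v)%bool.
Proof.
  intros H H'. apply cp_ext with (fun v => Nat.b2n (f v) * Nat.b2n (g v)).
  - intros v. destruct (f v), (g v); reflexivity.
  - now apply cp_mul.
Qed.

Lemma cpb_orb f g : cpb f -> cpb g -> cpb (fun v => f v || g v)%bool.
Proof.
  intros H H'. apply cpb_ext with (fun v => negb (negb (f v) && negb (g v))).
  - intros v. destruct (f v), (g v); reflexivity.
  - now apply cpb_negb, cpb_andb; apply cpb_negb.
Qed.

Lemma cpb_true : cpb (fun _ => true).
Proof. apply (cp_const 1). Qed.

Lemma cpb_ltb a b : cp a -> cp b -> cpb (fun v => a v <? b v).
Proof. intros. apply (cpb_leb (fun v => S (a v))); auto. now apply cp_S. Qed.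

Lemma cpb_eqb a b : cp a -> cp b -> cpb (fun v => a v =? b v).
Proof.
  intros. apply cpb_ext with (fun v => (a v <=? b v) && (b v <=? a v))%bool.
  - intros v. destruct (Nat.leb_spec (a v) (b v)), (Nat.leb_spec (b v) (a v)),
      (Nat.eqb_spec (a v) (b v)); simpl; auto; lia.
  - now apply cpb_andb; apply cpb_leb.
Qed.

Lemma cpb_even a : cp a -> cpb (fun v => Nat.even (a v)).
Proof.
  intros H. eapply cp_ext; [|apply (cp_rec (fun _ => 1) (fun _ r _ => 1 - r) a);
    [apply cp_const|apply cp_sub; [apply cp_const|apply cp_var]|exact H]].
  intros v. cbv beta. induction (a v) as [|m IH]; [reflexivity|].
  cbn [nat_rect]. rewrite IH, Nat.even_succ, <- Nat.negb_even. destruct (Nat.even m); reflexivity.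
Qed.

Lemma cp_div2 a : cp a -> cp (fun v => Nat.div2 (a v)).
Proof.
  intros H. apply (cp_app1 Nat.div2); auto.
  eapply cp_ext; [|apply (cp_rec (fun _ => 0) (fun i r _ => if Nat.even i then r else S r) (fun v => v 0));
    [apply cp_const|apply cp_if; [apply cpb_even, cp_var|apply cp_var|apply cp_S, cp_var]|apply cp_var]].
  intros v. cbv beta. induction (v 0) as [|m IH]; [reflexivity|].
  cbn [nat_rect]. rewrite IH.
  destruct (Nat.even m) eqn:E.
  - apply Nat.even_spec in E. destruct E as [j ->].
    rewrite Nat.div2_succ_double, Nat.div2_double. reflexivity.
  - assert (Nat.odd m = true) as E' by (rewrite <- Nat.negb_even, E; auto).
    apply Nat.odd_spec in E'. destruct E' as [j ->].
    replace (S (2 * j + 1)) with (2 * S j) by lia. replace (2 * j + 1) with (S (2 * j)) by lia.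
    rewrite Nat.div2_succ_double, Nat.div2_double. reflexivity.
Qed.

(** Least witness below [n], in the convention of associates: 0 means none found, [S i] reports [i].
    Being a recursion, it needs no [pMu]. *)
Definition bmu (n : nat) (f : nat -> bool) : nat :=
  nat_rect (fun _ => nat) 0 (fun i r => if r =? 0 then (if f i then S i else 0) else r) n.

Lemma bmu_zero n f : bmu n f = 0 -> forall i, i < n -> f i = false.
Proof.
  induction n as [|n IH]; simpl; intros H i Hi; [lia|].
  destruct (Nat.eqb_spec (bmu n f) 0) as [E|E].
  - destruct (f n) eqn:Ef; [discriminate|].
    destruct (Nat.eq_dec i n) as [->|]; auto. apply IH; auto; lia.
  - congruence.
Qed.

Lemma bmu_succ n f k : bmu n f = S k ->
  k < n /\ f k = true /\ forall i, i < k -> f i = false.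
Proof.
  induction n as [|n IH]; simpl; intros H; [discriminate|].
  destruct (Nat.eqb_spec (bmu n f) 0) as [E|E].
  - destruct (f n) eqn:Ef; [|discriminate]. injection H as <-.
    repeat split; auto. now apply bmu_zero.
  - destruct (IH H) as (?&?&?). repeat split; auto.
Qed.

Lemma bmu_least n f k :
  k < n -> f k = true -> (forall i, i < k -> f i = false) -> bmu n f = S k.
Proof.
  intros Hk Hf Hl. destruct (bmu n f) as [|j] eqn:E.
  - rewrite (bmu_zero _ _ E k Hk) in Hf. discriminate.
  - destruct (bmu_succ _ _ _ E) as (Hj & Hfj & Hlj).
    destruct (Nat.lt_trichotomy j k) as [L|[->|L]]; auto.
    + rewrite (Hl _ L) in Hfj. discriminate.
    + rewrite (Hlj _ L) in Hf. discriminate.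
Qed.

Definition bex (n : nat) (f : nat -> bool) : bool := negb (bmu n f =? 0).

Lemma bex_true n f : bex n f = true <-> exists i, i < n /\ f i = true.
Proof.
  unfold bex. destruct (bmu n f) as [|k] eqn:E; simpl; split; try discriminate.
  - intros (i & Hi & Hf). rewrite (bmu_zero _ _ E i Hi) in Hf. discriminate.
  - intros _. apply bmu_succ in E. exists k. tauto.
  - auto.
Qed.

Lemma cp_bmu (f : nat -> (nat -> nat) -> bool) n :
  cp n -> cpb (fun w => f (w 0) (fun i => w (S i))) -> cp (fun v => bmu (n v) (fun i => f i v)).
Proof.
  intros Hn Hf.
  apply (cp_rec (fun _ => 0) (fun i r v => if r =? 0 then (if f i v then S i else 0) else r) n);
    auto using cp_zero.
  apply cp_if; [apply cpb_eqb; [apply cp_var|apply cp_zero]| |apply cp_var].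
  apply cp_if; [|apply cp_S, cp_var|apply cp_zero].
  apply (cp_subst _ (fun v i => v (match i with 0 => 0 | S i => S (S i) end)) Hf).
  intros i. apply cp_var.
Qed.

Lemma cpb_bex (f : nat -> (nat -> nat) -> bool) n :
  cp n -> cpb (fun w => f (w 0) (fun i => w (S i))) -> cpb (fun v => bex (n v) (fun i => f i v)).
Proof.
  intros Hn Hf. apply cpb_negb, cpb_eqb; [now apply cp_bmu|apply cp_zero].
Qed.

(** * Pairing and codes of finite prefixes *)

Definition tri (n : nat) : nat := nat_rect (fun _ => nat) 0 (fun i r => S i + r) n.

Lemma npair_tri a b : npair a b = tri (a + b) + a.
Proof.
  unfold npair. f_equal.
  assert (forall n, n * (n + 1) = tri n * 2) as H.
  { induction n; simpl; [reflexivity|]. simpl in *. lia. }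
  rewrite H. now rewrite Nat.div_mul.
Qed.

Lemma npair_unpair k : npair (fst (unpair k)) (snd (unpair k)) = k.
Proof.
  rewrite npair_tri. induction k as [|k IH]; [reflexivity|].
  simpl unpair. destruct (unpair k) as [a [|b]]; simpl fst in *; simpl snd in *.
  - rewrite Nat.add_0_r in *. simpl. lia.
  - replace (S a + b) with (a + S b) by lia. lia.
Qed.

Lemma tri_mono m n : m <= n -> tri m <= tri n.
Proof. induction 1; simpl; lia. Qed.

Lemma npair_inj a b c d : npair a b = npair c d -> a = c /\ b = d.
Proof.
  rewrite !npair_tri. intros H.
  assert (a + b = c + d) as E.
  { destruct (Nat.lt_trichotomy (a + b) (c + d)) as [L|[L|L]]; auto.
    - pose proof (tri_mono _ _ L) as T. simpl in T. lia.
    - pose proof (tri_mono _ _ L) as T. simpl in T. lia. }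
  rewrite E in H. lia.
Qed.

Lemma unpair_npair a b : unpair (npair a b) = (a, b).
Proof.
  pose proof (npair_unpair (npair a b)) as H. apply npair_inj in H.
  destruct (unpair (npair a b)); simpl in H. now destruct H; subst.
Qed.

Lemma le_npair a b : a <= npair a b /\ b <= npair a b.
Proof.
  rewrite npair_tri. split; [lia|].
  assert (forall n, n <= tri n) as H by (induction n; simpl; lia).
  specialize (H (a + b)). lia.
Qed.

Lemma unpair_le k : fst (unpair k) <= k /\ snd (unpair k) <= k.
Proof.
  pose proof (le_npair (fst (unpair k)) (snd (unpair k))) as H.
  now rewrite npair_unpair in H.
Qed.

Lemma cp_npair a b : cp a -> cp b -> cp (fun v => npair (a v) (b v)).
Proof.
  intros Ha Hb. apply cp_ext with (fun v => tri (a v + b v) + a v).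
  { intros. now rewrite npair_tri. }
  apply cp_add; auto. apply (cp_rec (fun _ => 0) (fun i r _ => S i + r));
    [apply cp_zero|apply cp_add; [apply cp_S|]; apply cp_var|now apply cp_add].
Qed.

(** Both components are at most the code, so unpairing is a bounded search for a pair with that
    code; [pred] strips the successor of [bmu]. *)
Lemma cp_fst a : cp a -> cp (fun v => fst (unpair (a v))).
Proof.
  apply (cp_app1 (fun x => fst (unpair x))).
  apply cp_ext with (fun v => pred (bmu (S (v 0)) (fun i => bex (S (v 0)) (fun j => npair i j =? v 0)))).
  - intros v. rewrite (bmu_least _ _ (fst (unpair (v 0)))); [reflexivity| | |].
    + pose proof (unpair_le (v 0)). lia.
    + apply bex_true. exists (snd (unpair (v 0))). split.
      * pose proof (unpair_le (v 0)). lia.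
      * apply Nat.eqb_eq, npair_unpair.
    + intros i Hi. destruct (bex _ _) eqn:E; auto. apply bex_true in E.
      destruct E as (j & _ & E). apply Nat.eqb_eq in E. rewrite <- E, unpair_npair in Hi.
      simpl in Hi. lia.
  - apply cp_pred. apply (cp_bmu (fun i v => bex (S (v 0)) (fun j => npair i j =? v 0))).
    { apply cp_S, cp_var. }
    apply (cpb_bex (fun j v => npair (v 0) j =? v 1)). { apply cp_S, cp_var. }
    apply cpb_eqb; [apply cp_npair|]; apply cp_var.
Qed.

Lemma cp_snd a : cp a -> cp (fun v => snd (unpair (a v))).
Proof.
  apply (cp_app1 (fun x => snd (unpair x))).
  apply cp_ext with (fun v => pred (bmu (S (v 0)) (fun j => npair (fst (unpair (v 0))) j =? v 0))).
  - intros v. rewrite (bmu_least _ _ (snd (unpair (v 0)))); [reflexivity| | |].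
    + pose proof (unpair_le (v 0)). lia.
    + apply Nat.eqb_eq, npair_unpair.
    + intros i Hi. apply Nat.eqb_neq. intros E. rewrite <- E in Hi at 1.
      rewrite unpair_npair in Hi. simpl in Hi. lia.
  - apply cp_pred. apply (cp_bmu (fun j v => npair (fst (unpair (v 0))) j =? v 0)).
    { apply cp_S, cp_var. }
    apply cpb_eqb; [|apply cp_var]. apply cp_npair; [apply cp_fst|]; apply cp_var.
Qed.

(** The empty list has code 0, which the step fixes, so reading past the end yields 0. This is why a
    code of a prefix behaves like [trunc], the sequence continued by zeros. *)
Definition cdrop (j c : nat) : nat := nat_rect (fun _ => nat) c (fun _ r => snd (unpair (pred r))) j.
Definition chd (c : nat) : nat := fst (unpair (pred c)).
Definition cseq (c : nat) : baire := fun j => chd (cdrop (S j) c).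
(** One predecessor undoes the successor of [bmu], the other discounts the output index that
    precedes the prefix in the input of an associate. *)
Definition clen (c : nat) : nat := pred (pred (bmu (S (S c)) (fun j => cdrop j c =? 0))).
Definition trunc (p : baire) (m : nat) : baire := fun j => if j <? m then p j else 0.

Lemma cp_cdrop a b : cp a -> cp b -> cp (fun v => cdrop (a v) (b v)).
Proof.
  intros Ha Hb. apply (cp_rec b (fun _ r _ => snd (unpair (pred r))) a Hb); auto.
  apply cp_snd, cp_pred, cp_var.
Qed.

Lemma cp_chd a : cp a -> cp (fun v => chd (a v)).
Proof. intros Ha. now apply cp_fst, cp_pred. Qed.

Lemma cp_cseq a b : cp a -> cp b -> cp (fun v => cseq (a v) (b v)).
Proof. intros Ha Hb. apply cp_chd, cp_cdrop; auto. now apply cp_S. Qed.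

Lemma cp_clen a : cp a -> cp (fun v => clen (a v)).
Proof.
  intros Ha. apply (cp_app1 clen); auto. apply cp_pred, cp_pred.
  apply (cp_bmu (fun j v => cdrop j (v 0) =? 0)). { apply cp_S, cp_S, cp_var. }
  apply cpb_eqb; [apply cp_cdrop|apply cp_zero]; apply cp_var.
Qed.

Lemma cdrop_code_list j l : cdrop j (code_list l) = code_list (skipn j l).
Proof.
  assert (forall l, snd (unpair (pred (code_list l))) = code_list (tl l)) as H.
  { intros [|x l']; [reflexivity|]. simpl. now rewrite unpair_npair. }
  induction j as [|j IH]; [reflexivity|]. unfold cdrop in *. cbn [nat_rect]. rewrite IH, H.
  f_equal. clear. revert l. induction j; intros [|x l]; simpl; auto.
Qed.

Lemma chd_code_list l : chd (code_list l) = hd 0 l.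
Proof. destruct l; [reflexivity|]. unfold chd. simpl. now rewrite unpair_npair. Qed.

Lemma length_le_code l : length l <= code_list l.
Proof.
  induction l as [|a l IH]; simpl; [lia|].
  pose proof (le_npair a (code_list l)). lia.
Qed.

Lemma cseq_prefix i p m : cseq (code_list (i :: prefix p m)) = trunc p m.
Proof.
  apply functional_extensionality. intros j. unfold cseq, trunc.
  rewrite cdrop_code_list, chd_code_list. cbn [skipn].
  assert (forall l : list nat, hd 0 (skipn j l) = nth j l 0) as E.
  { clear. induction j; intros [|x l]; simpl; auto. }
  rewrite E. unfold prefix. destruct (Nat.ltb_spec j m).
  - rewrite (nth_indep _ 0 (p 0)) by (rewrite length_map, length_seq; lia).
    now rewrite map_nth, seq_nth by lia.
  - apply nth_overflow. rewrite length_map, length_seq. lia.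
Qed.

Lemma clen_prefix i p m : clen (code_list (i :: prefix p m)) = m.
Proof.
  set (l := i :: prefix p m).
  assert (length l = S m) as Hl by (unfold l, prefix; cbn [length]; now rewrite length_map, length_seq).
  unfold clen. rewrite (bmu_least _ _ (S m)); [reflexivity| | |].
  - pose proof (length_le_code l). lia.
  - rewrite cdrop_code_list, skipn_all2; [reflexivity|lia].
  - intros j Hj. rewrite cdrop_code_list.
    pose proof (length_skipn j l) as L. destruct (skipn j l); [cbn [length] in L; lia|reflexivity].
Qed.

(** [T p m i k] means that [k] is acceptable as output [i] once [m] entries are known. At the first
    stage where some [k < m] is accepted, the associate returns the least one. It need not be the
    eventually accepted [k] of the hypothesis, so [T] must be such that acceptance at any stage
    guarantees a correct value. *)
Lemma search_functional (T : baire -> nat -> nat -> nat -> bool) :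
  cpb (fun v => T (cseq (v 0)) (v 1) (v 2) (v 3)) ->
  exists h, computable_nat h /\ forall p,
    (forall i, exists m0 k, forall m, m0 <= m -> T (trunc p m) m i k = true) ->
    exists q, assoc_apply h p q /\ forall i, exists m, T (trunc p m) m i (q i) = true.
Proof.
  intros HT. set (h := fun c => bmu (clen c) (fun k => T (cseq c) (clen c) (chd c) k)).
  exists h. split.
  { apply cp_computable.
    apply (cp_bmu (fun k v => T (cseq (v 0)) (clen (v 0)) (chd (v 0)) k)).
    { apply cp_clen, cp_var. }
    apply (cp_subst _ (fun v i => match i with 0 => v 1 | 1 => clen (v 1) | 2 => chd (v 1) | _ => v 0 end) HT).
    intros [|[|[|i]]]; [apply cp_var|apply cp_clen, cp_var|apply cp_chd, cp_var|apply cp_var]. }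
  intros p Hp.
  assert (E : forall i m, h (code_list (i :: prefix p m)) = bmu m (fun k => T (trunc p m) m i k)).
  { intros i m. unfold h. rewrite cseq_prefix, clen_prefix, chd_code_list. reflexivity. }
  assert (Hi : forall i, exists x, exists m, (forall k, k < m -> h (code_list (i :: prefix p k)) = 0) /\
      h (code_list (i :: prefix p m)) = S x /\ T (trunc p m) m i x = true).
  { intros i. destruct (Hp i) as (m0 & k & Hk).
    set (f := fun m => negb (h (code_list (i :: prefix p m)) =? 0)).
    (* At stage [max m0 (S k)] the candidate [k] is already accepted and lies below the search
       bound. *)
    set (N := S (max m0 (S k))).
    assert (bmu N f <> 0) as HN.
    { intros Z. pose proof (bmu_zero _ _ Z (max m0 (S k)) ltac:(lia)) as F.
      unfold f in F. rewrite E in F.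
      destruct (bmu _ _) eqn:B in F; [|discriminate].
      pose proof (bmu_zero _ _ B k ltac:(lia)) as C. simpl in C. rewrite Hk in C by lia. discriminate. }
    destruct (bmu N f) as [|m] eqn:B; [congruence|].
    apply bmu_succ in B. destruct B as (_ & Hm & Hl). unfold f in Hm, Hl.
    destruct (h (code_list (i :: prefix p m))) as [|x] eqn:Ex; [discriminate|].
    exists x, m. split; [|split; auto].
    - intros k' Hk'. specialize (Hl k' Hk').
      now destruct (Nat.eqb_spec (h (code_list (i :: prefix p k'))) 0).
    - rewrite E in Ex. now apply bmu_succ in Ex. }
  exists (fun i => proj1_sig (constructive_indefinite_description _ (Hi i))).
  split; intros i; destruct (constructive_indefinite_description _ (Hi i)) as (x & m & H1 & H2 & H3);
    simpl; exists m; auto.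
Qed.

(** The output may depend on the least stage at which [cond] holds: that stage does not change
    when a longer prefix is seen. *)
Lemma staged_functional (cond : baire -> nat -> bool) (out : baire -> nat -> nat -> nat) (g : nat -> nat) :
  cpb (fun v => cond (cseq (v 0)) (v 1)) ->
  cp (fun v => out (cseq (v 0)) (v 1) (v 2)) ->
  cp (fun v => g (v 0)) ->
  (forall p m M, M <= m -> cond (trunc p m) M = cond p M) ->
  (forall p m M i, g i <= m -> out (trunc p m) M i = out p M i) ->
  exists h, computable_nat h /\ forall p, (exists m, cond p m = true) ->
    exists q M, cond p M = true /\ assoc_apply h p q /\ forall i, q i = out p M i.
Proof.
  intros Hc Ho Hg Lc Lo.
  set (stage := fun p m => bmu (S m) (fun M => cond p M)).
  (* Only one value is acceptable, the output for the least stage, and only after the [g i] entries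
     that determine it have been read. *)
  set (T := fun (p : baire) m i k =>
    (negb (stage p m =? 0) && ((g i <=? m) && (k =? out p (pred (stage p m)) i)))%bool).
  assert (Hst : cp (fun v => stage (cseq (v 0)) (v 1))).
  { apply (cp_bmu (fun M v => cond (cseq (v 0)) M)). { apply cp_S, cp_var. }
    apply (cp_subst _ (fun v i => match i with 0 => v 1 | _ => v 0 end) Hc).
    intros [|i]; apply cp_var. }
  destruct (search_functional T) as (h & Hh & H).
  { unfold T. repeat apply cpb_andb.
    - apply cpb_negb, cpb_eqb; [exact Hst|apply cp_zero].
    - apply cpb_leb; [apply (cp_app1 g); auto|]; apply cp_var.
    - apply cpb_eqb; [apply cp_var|].
      apply (cp_subst _ (fun v i => match i with 0 => v 0 | 1 => pred (stage (cseq (v 0)) (v 1)) | _ => v 2 end) Ho).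
      intros [|[|i]]; [apply cp_var|now apply cp_pred|apply cp_var]. }
  exists h. split; auto. intros p (m1 & Hm1).
  assert (exists M, forall m, m1 <= m -> stage p m = S M) as (M & HM).
  { destruct (stage p m1) as [|M] eqn:E.
    - apply bmu_zero with (i := m1) in E; [congruence|lia].
    - exists M. intros m Hm. apply bmu_succ in E. destruct E as (?&?&?).
      apply bmu_least; auto. lia. }
  assert (St : forall m, stage (trunc p m) m = stage p m).
  { intros m. unfold stage.
    assert (forall n, n <= S m -> bmu n (fun M => cond (trunc p m) M) = bmu n (fun M => cond p M)) as W.
    { induction n; intros Hn; [reflexivity|]. simpl. rewrite IHn, Lc by lia. reflexivity. }
    apply W. lia. }
  destruct (H p) as (q & Hq & HT).
  { intros i. exists (max m1 (g i)), (out p M i). intros m Hm. unfold T.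
    rewrite St, HM, Lo by lia. cbn. rewrite Nat.eqb_refl.
    destruct (Nat.leb_spec (g i) m); auto; lia. }
  exists q, M. split; [|split; auto].
  - specialize (HM m1 (le_n _)). now apply bmu_succ in HM.
  - intros i. destruct (HT i) as (m & Hm). unfold T in Hm.
    apply andb_prop in Hm as [A Hm]. apply andb_prop in Hm as [B C].
    apply Nat.leb_le in B. apply Nat.eqb_eq in C. rewrite C, St, Lo by auto. f_equal.
    rewrite St in A. destruct (stage p m) as [|M'] eqn:E; [discriminate|].
    apply bmu_succ in E. specialize (HM m1 (le_n _)). apply bmu_succ in HM.
    destruct E as (_ & E1 & E2), HM as (_ & E3 & E4). simpl.
    destruct (Nat.lt_trichotomy M M') as [L|[L|L]]; auto.
    + rewrite E2 in E3 by auto. discriminate.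
    + rewrite E4 in E1 by auto. discriminate.
Qed.

(** * Rational-valued functions and decidable inequalities *)

(** A difference of naturals over a positive denominator, not reduced: signed rational arithmetic
    becomes arithmetic on naturals. *)
Definition cr (f : (nat -> nat) -> R) : Prop :=
  exists P M D, cp P /\ cp M /\ cp D /\
    forall v, f v = ((INR (P v) - INR (M v)) / INR (S (D v)))%R.

Lemma cr_ext f g : (forall v, f v = g v) -> cr f -> cr g.
Proof.
  intros E (P & M & D & ? & ? & ? & H). exists P, M, D. repeat split; auto.
  intros. now rewrite <- E.
Qed.

Lemma cr_INR a : cp a -> cr (fun v => INR (a v)).
Proof.
  intros H. exists a, (fun _ => 0), (fun _ => 0). repeat split; auto using cp_zero.
  intros v. simpl. field.
Qed.

Lemma cr_opp f : cr f -> cr (fun v => (- f v)%R).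
Proof.
  intros (P & M & D & ? & ? & ? & H). exists M, P, D. repeat split; auto.
  intros v. rewrite H. field. apply not_0_INR. lia.
Qed.

Lemma cr_add f g : cr f -> cr g -> cr (fun v => (f v + g v)%R).
Proof.
  intros (P & M & D & HP & HM & HD & H) (P' & M' & D' & HP' & HM' & HD' & H').
  exists (fun v => P v * S (D' v) + P' v * S (D v)), (fun v => M v * S (D' v) + M' v * S (D v)),
    (fun v => pred (S (D v) * S (D' v))).
  repeat split; [| | |intros v].
  1,2: apply cp_add; apply cp_mul; auto using cp_S.
  { apply cp_pred, cp_mul; auto using cp_S. }
  rewrite H, H', Nat.succ_pred, !plus_INR, !mult_INR by lia.
  field. split; apply not_0_INR; lia.
Qed.

Lemma cr_sub f g : cr f -> cr g -> cr (fun v => (f v - g v)%R).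
Proof. intros. apply (cr_add f (fun v => (- g v)%R)); auto using cr_opp. Qed.

Lemma cr_mul f g : cr f -> cr g -> cr (fun v => (f v * g v)%R).
Proof.
  intros (P & M & D & HP & HM & HD & H) (P' & M' & D' & HP' & HM' & HD' & H').
  exists (fun v => P v * P' v + M v * M' v), (fun v => P v * M' v + M v * P' v),
    (fun v => pred (S (D v) * S (D' v))).
  repeat split; [| | |intros v].
  1,2: apply cp_add; apply cp_mul; auto using cp_S.
  { apply cp_pred, cp_mul; auto using cp_S. }
  rewrite H, H', Nat.succ_pred, !plus_INR, !mult_INR by lia.
  field. split; apply not_0_INR; lia.
Qed.

Lemma cr_inv f : cr f -> cr (fun v => (/ f v)%R).
Proof.
  intros (P & M & D & HP & HM & HD & H).
  (* In truncated subtraction [1 - (1 - a)] is 0 for [a = 0] and 1 otherwise, so the numerator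
     carries the sign of P - M and the denominator is |P - M|. If P = M the numerator vanishes, in
     accordance with [Rinv_0]. *)
  exists (fun v => S (D v) * (1 - (1 - (P v - M v)))), (fun v => S (D v) * (1 - (1 - (M v - P v)))),
    (fun v => pred ((P v - M v) + (M v - P v))).
  repeat split; [| | |intros v].
  1,2: apply cp_mul; auto using cp_S, cp_sub, cp_const.
  { apply cp_pred, cp_add; auto using cp_sub. }
  rewrite H.
  assert (INR (S (D v)) <> 0%R) as HD0 by (apply not_0_INR; lia).
  destruct (Nat.lt_trichotomy (P v) (M v)) as [L|[L|L]].
  - replace (P v - M v) with 0 by lia. replace (1 - (1 - (M v - P v))) with 1 by lia.
    rewrite Nat.succ_pred by lia. simpl (1 - _). rewrite Nat.mul_0_r, Nat.mul_1_r.
    replace (INR (0 + (M v - P v))) with (INR (M v) - INR (P v))%R by (rewrite <- minus_INR by lia; reflexivity).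
    apply lt_INR in L. simpl (INR 0). field. repeat split; lra.
  - rewrite L, Nat.sub_diag. simpl (1 - _). rewrite Nat.mul_0_r.
    unfold Rdiv. rewrite !Rminus_diag, !Rmult_0_l. apply Rinv_0.
  - replace (M v - P v) with 0 by lia. replace (1 - (1 - (P v - M v))) with 1 by lia.
    rewrite Nat.succ_pred by lia. simpl (1 - _). rewrite Nat.mul_0_r, Nat.mul_1_r, Nat.add_0_r.
    rewrite minus_INR by lia.
    apply lt_INR in L. simpl (INR 0). field. repeat split; lra.
Qed.

Lemma cr_pow f k : cr f -> cr (fun v => (f v ^ k)%R).
Proof.
  intros H. induction k; simpl; [apply (cr_INR (fun _ => 1)), cp_const|now apply cr_mul].
Qed.

Lemma cr_INR_const k : cr (fun _ => INR k).
Proof. apply cr_INR, cp_const. Qed.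

Lemma cr_inv_pow2 a : cp a -> cr (fun v => (/ 2 ^ a v)%R).
Proof.
  intros H. apply cr_inv. apply cr_ext with (fun v => INR (2 ^ a v)).
  - intros. now rewrite pow_INR.
  - apply cr_INR, cp_pow; auto using cp_const.
Qed.

(** Classical on the reals, but decided by integer arithmetic on rational-valued functions ([cpb_rleb]). *)
Definition rleb (x y : R) : bool := if Rle_dec x y then true else false.

Lemma rleb_true x y : rleb x y = true <-> (x <= y)%R.
Proof. unfold rleb. destruct (Rle_dec x y); split; auto; try discriminate; tauto. Qed.

Lemma rleb_false x y : rleb x y = false <-> (y < x)%R.
Proof. unfold rleb. destruct (Rle_dec x y); split; auto; try discriminate; lra. Qed.

Lemma bool_iff (a b : bool) : (a = true <-> b = true) -> a = b.
Proof. destruct a, b; intuition; symmetry; auto. Qed.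

Lemma cpb_rleb f g : cr f -> cr g -> cpb (fun v => rleb (f v) (g v)).
Proof.
  intros (P & M & D & HP & HM & HD & H) (P' & M' & D' & HP' & HM' & HD' & H').
  apply cpb_ext with (fun v => P v * S (D' v) + M' v * S (D v) <=? P' v * S (D v) + M v * S (D' v)).
  2: apply cpb_leb; apply cp_add; apply cp_mul; auto using cp_S.
  intros v. apply bool_iff. rewrite rleb_true, Nat.leb_le, H, H'.
  assert (0 < INR (S (D v)))%R by (apply lt_0_INR; lia).
  assert (0 < INR (S (D' v)))%R by (apply lt_0_INR; lia).
  assert (E : forall a b c d x y : R, (0 < x -> 0 < y ->
     (a - b) / x <= (c - d) / y <-> a * y + d * x <= c * x + b * y)%R).
  { intros a b c d x y Hx Hy. split; intros L.
    - apply (Rmult_le_compat_r (x * y)) in L; [|nra]. field_simplify in L; try lra.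
    - apply (Rmult_le_reg_r (x * y)); [nra|]. field_simplify; try lra. }
  rewrite E, <- !mult_INR, <- !plus_INR by auto.
  split; [apply le_INR|apply INR_le].
Qed.

Lemma Q2R_decQ k : Q2R (decQ k) =
  ((INR (if Nat.even (fst (unpair k)) then Nat.div2 (fst (unpair k)) else 0)
   - INR (if Nat.even (fst (unpair k)) then 0 else S (Nat.div2 (fst (unpair k)))))
   / INR (S (snd (unpair k))))%R.
Proof.
  unfold decQ. destruct (unpair k) as [a b]. cbn [fst snd]. unfold Q2R. cbn [Qnum Qden].
  unfold Rdiv. f_equal.
  - unfold decZ. destruct (Nat.even a).
    + rewrite <- INR_IZR_INZ. simpl (INR 0). ring.
    + rewrite opp_IZR, <- INR_IZR_INZ. simpl (INR 0). ring.
  - rewrite INR_IZR_INZ. reflexivity.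
Qed.

Lemma cr_decQ a : cp a -> cr (fun v => Q2R (decQ (a v))).
Proof.
  intros H.
  exists (fun v => if Nat.even (fst (unpair (a v))) then Nat.div2 (fst (unpair (a v))) else 0),
    (fun v => if Nat.even (fst (unpair (a v))) then 0 else S (Nat.div2 (fst (unpair (a v))))),
    (fun v => snd (unpair (a v))).
  repeat split; auto using cp_if, cpb_even, cp_fst, cp_snd, cp_zero, cp_div2, cp_S.
  intros v. apply Q2R_decQ.
Qed.

Lemma Q2R_Qabs q : Q2R (Qabs q) = Rabs (Q2R q).
Proof.
  destruct q as [z d]. unfold Q2R. simpl.
  rewrite Rabs_mult, abs_IZR. f_equal. symmetry. apply Rabs_pos_eq.
  left. apply Rinv_0_lt_compat, IZR_lt. lia.
Qed.

Lemma cr_radius a : cp a -> cr (fun v => ball_radius (a v)).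
Proof.
  intros H.
  exists (fun v => if Nat.even (fst (unpair (snd (unpair (a v)))))
                   then Nat.div2 (fst (unpair (snd (unpair (a v)))))
                   else S (Nat.div2 (fst (unpair (snd (unpair (a v))))))),
    (fun _ => 0), (fun v => snd (unpair (snd (unpair (a v))))).
  repeat split; auto using cp_if, cpb_even, cp_fst, cp_snd, cp_zero, cp_div2, cp_S.
  { apply cp_if; auto 10 using cpb_even, cp_fst, cp_snd, cp_div2, cp_S. }
  intros v. unfold ball_radius. rewrite Q2R_Qabs, Q2R_decQ.
  set (k := snd (unpair (a v))).
  unfold Rdiv. rewrite Rabs_mult, (Rabs_pos_eq (/ _)).
  2: { left. apply Rinv_0_lt_compat, lt_0_INR. lia. }
  f_equal. destruct (Nat.even _).
  - simpl (INR 0). rewrite Rminus_0_r. apply Rabs_pos_eq, pos_INR.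
  - simpl (INR 0). rewrite Rminus_0_r, Rminus_0_l, Rabs_Ropp. apply Rabs_pos_eq, pos_INR.
Qed.

Definition crv (X : (nat -> nat) -> nat -> R) : Prop := forall i, cr (fun v => X v i).

Lemma cp_coord i a : cp a -> cp (fun v => coord (a v) i).
Proof.
  revert a. induction i; intros a H; simpl; [now apply cp_fst|].
  apply (IHi (fun v => snd (unpair (a v)))). now apply cp_snd.
Qed.

Lemma crv_Qvec n a : cp a -> crv (fun v => proj1_sig (Qvec n (a v))).
Proof.
  intros H i. simpl. destruct (i <? n).
  - apply cr_decQ. now apply cp_coord.
  - apply (cr_INR_const 0).
Qed.

Lemma crv_center n a : cp a -> crv (fun v => proj1_sig (ball_center n (a v))).
Proof. intros H. apply (crv_Qvec n (fun v => fst (unpair (a v)))). now apply cp_fst. Qed.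

Lemma cr_sumsq n X Y : crv X -> crv Y -> cr (fun v => sumsq n (X v) (Y v)).
Proof.
  intros HX HY. induction n; simpl; [apply (cr_INR_const 0)|].
  apply cr_add; auto. apply (cr_pow (fun v => (X v n - Y v n)%R) 2). apply cr_sub; auto.
Qed.

Definition dn (n : nat) (x y : nat -> R) : R := sqrt (sumsq n x y).

Lemma sumsq_ge0 n x y : (0 <= sumsq n x y)%R.
Proof. induction n; simpl; [lra|]. pose proof (pow2_ge_0 (x n - y n)). simpl in *. lra. Qed.

(** Squaring removes the root and leaves rational comparisons; the sign of [e] is tested separately,
    since squaring forgets it. *)
Lemma cpb_dn_le n X Y e : crv X -> crv Y -> cr e -> cpb (fun v => rleb (dn n (X v) (Y v)) (e v)).
Proof.
  intros HX HY He.
  apply cpb_ext with (fun v => rleb (INR 0) (e v) && rleb (sumsq n (X v) (Y v)) (e v ^ 2))%bool.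
  - intros v. apply bool_iff. rewrite Bool.andb_true_iff, !rleb_true. simpl (INR 0).
    pose proof (sumsq_ge0 n (X v) (Y v)) as G. unfold dn. split.
    + intros [A B]. rewrite <- (sqrt_pow2 (e v)) by auto. now apply sqrt_le_1_alt.
    + intros A. pose proof (sqrt_pos (sumsq n (X v) (Y v))). split; [lra|].
      rewrite <- (pow2_sqrt _ G). apply pow_incr. lra.
  - apply cpb_andb; apply cpb_rleb; auto using cr_INR_const, cr_sumsq, cr_pow.
Qed.

Lemma cpb_dn_ge n X Y e : crv X -> crv Y -> cr e -> cpb (fun v => rleb (e v) (dn n (X v) (Y v))).
Proof.
  intros HX HY He.
  apply cpb_ext with (fun v => rleb (e v) (INR 0) || rleb (e v ^ 2) (sumsq n (X v) (Y v)))%bool.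
  - intros v. apply bool_iff. rewrite Bool.orb_true_iff, !rleb_true. simpl (INR 0).
    pose proof (sumsq_ge0 n (X v) (Y v)) as G. unfold dn.
    pose proof (sqrt_pos (sumsq n (X v) (Y v))). split.
    + intros [A|B]; [lra|]. destruct (Rle_dec (e v) 0); [lra|].
      rewrite <- (sqrt_pow2 (e v)) by lra. now apply sqrt_le_1_alt.
    + intros A. destruct (Rle_dec (e v) 0); [now left|right].
      rewrite <- (pow2_sqrt _ G). apply pow_incr. lra.
  - apply cpb_orb; apply cpb_rleb; auto using cr_INR_const, cr_sumsq, cr_pow.
Qed.

(** * Geometry of the Euclidean space *)

Open Scope R_scope.

Lemma sumsq_ext n x y x' y' :
  (forall i, (i < n)%nat -> (x i - y i) ^ 2 = (x' i - y' i) ^ 2) -> sumsq n x y = sumsq n x' y'.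
Proof.
  induction n as [|n IH]; intros H; cbn [sumsq]; [reflexivity|].
  rewrite IH by (intros; apply H; lia). rewrite (H n) by lia. reflexivity.
Qed.

Lemma dn_ext n x y x' y' :
  (forall i, (i < n)%nat -> x i - y i = x' i - y' i) -> dn n x y = dn n x' y'.
Proof.
  intros H. unfold dn. f_equal. apply sumsq_ext. intros i Hi. now rewrite H.
Qed.

Lemma dn_sym n x y : dn n x y = dn n y x.
Proof. unfold dn. f_equal. apply sumsq_ext. intros. ring. Qed.

Lemma dn_ge0 n x y : 0 <= dn n x y.
Proof. apply sqrt_pos. Qed.

Lemma dn_sq n x y : dn n x y ^ 2 = sumsq n x y.
Proof. apply pow2_sqrt, sumsq_ge0. Qed.

Lemma dn_self n x : dn n x x = 0.
Proof.
  unfold dn. rewrite <- sqrt_0. f_equal. induction n; cbn [sumsq]; [reflexivity|]. rewrite IHn. ring.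
Qed.

(** The triangle inequality in the plane, with [C <= A + B] as the inductive hypothesis in one
    dimension less. Its core is the Cauchy-Schwarz inequality, from (Ab - aB)^2 >= 0. *)
Lemma minkowski_step A B C a b c :
  0 <= A -> 0 <= B -> 0 <= C -> C <= A + B -> c = a + b ->
  sqrt (C ^ 2 + c ^ 2) <= sqrt (A ^ 2 + a ^ 2) + sqrt (B ^ 2 + b ^ 2).
Proof.
  intros HA HB HC HL ->.
  set (s := sqrt (A ^ 2 + a ^ 2)). set (t := sqrt (B ^ 2 + b ^ 2)).
  assert (Hs : 0 <= s) by apply sqrt_pos. assert (Ht : 0 <= t) by apply sqrt_pos.
  assert (Es : s ^ 2 = A ^ 2 + a ^ 2) by (apply pow2_sqrt; nra).
  assert (Et : t ^ 2 = B ^ 2 + b ^ 2) by (apply pow2_sqrt; nra).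
  assert (Hst : A * B + a * b <= s * t).
  { apply Rsqr_incr_0_var; [|nra]. unfold Rsqr.
    replace (s * t * (s * t)) with (s ^ 2 * t ^ 2) by ring. rewrite Es, Et.
    pose proof (pow2_ge_0 (A * b - a * B)). nra. }
  rewrite <- (sqrt_pow2 (s + t)) by lra. apply sqrt_le_1_alt. nra.
Qed.

Lemma dn_triangle n x y z : dn n x z <= dn n x y + dn n y z.
Proof.
  induction n as [|n IH]; [unfold dn; cbn [sumsq]; rewrite sqrt_0; lra|].
  unfold dn. cbn [sumsq]. rewrite <- !dn_sq. apply minkowski_step; auto using dn_ge0. ring.
Qed.

Lemma dn_scale n t x y : dn n (fun i => t * x i) (fun i => t * y i) = Rabs t * dn n x y.
Proof.
  assert (E : sumsq n (fun i => t * x i) (fun i => t * y i) = t ^ 2 * sumsq n x y).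
  { induction n; cbn [sumsq]; [ring|]. rewrite IHn. ring. }
  unfold dn. rewrite E, sqrt_mult_alt by apply pow2_ge_0.
  f_equal. rewrite <- Rsqr_pow2. apply sqrt_Rsqr_abs.
Qed.

Lemma dn_add n x y u w : dn n (fun i => x i + u i) (fun i => y i + w i) <= dn n x y + dn n u w.
Proof.
  eapply Rle_trans; [apply (dn_triangle n _ (fun i => y i + u i))|].
  apply Rplus_le_compat; right; apply dn_ext; intros; ring.
Qed.

Lemma dn_le_coord n x y e : (forall i, (i < n)%nat -> Rabs (x i - y i) <= e) -> dn n x y <= INR n * e.
Proof.
  induction n as [|n IH]; intros H.
  - unfold dn. cbn [sumsq]. rewrite sqrt_0. simpl. lra.
  - assert (IH' : dn n x y <= INR n * e) by (apply IH; intros; apply H; lia).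
    assert (Hn : Rabs (x n - y n) <= e) by (apply H; lia).
    pose proof (dn_ge0 n x y). pose proof (Rabs_pos (x n - y n)).
    unfold dn. cbn [sumsq]. rewrite <- dn_sq, <- (pow2_abs (x n - y n)), S_INR.
    rewrite <- (sqrt_pow2 ((INR n + 1) * e)) by lra.
    apply sqrt_le_1_alt. nra.
Qed.

Lemma inv_INR_small d : 0 < d -> exists b, / INR (S b) < d.
Proof.
  intros H. destruct (archimed_cor1 d H) as (N & H1 & H2). exists (pred N).
  now rewrite Nat.succ_pred by lia.
Qed.

Lemma inv_pow2_small d : 0 < d -> exists t, / 2 ^ t < d.
Proof.
  intros H. destruct (inv_INR_small d H) as (b & Hb). exists (S b).
  eapply Rle_lt_trans; [|exact Hb]. apply Rinv_le_contravar; [apply lt_0_INR; lia|].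
  generalize (S b). intros m. induction m; [simpl; lra|]. rewrite S_INR. simpl.
  pose proof (pow_R1_Rle 2 m ltac:(lra)). lra.
Qed.

Lemma inv_pow2_pos t : 0 < / 2 ^ t.
Proof. apply Rinv_0_lt_compat, pow_lt. lra. Qed.

Lemma inv_pow2_anti i j : (i <= j)%nat -> / 2 ^ j <= / 2 ^ i.
Proof.
  intros H. apply Rinv_le_contravar; [apply pow_lt; lra|]. apply Rle_pow; auto; lra.
Qed.

Lemma decZ_surj z : exists k, decZ k = z.
Proof.
  destruct (Z.le_gt_cases 0 z) as [H|H].
  - exists (2 * Z.to_nat z)%nat. unfold decZ.
    rewrite Nat.even_mul, Nat.div2_double. simpl. lia.
  - exists (S (2 * Z.to_nat (- z - 1)))%nat. unfold decZ.
    rewrite Nat.even_succ, Nat.odd_mul, Nat.div2_succ_double.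
    change (Nat.odd 2) with false. cbn [andb]. lia.
Qed.

Lemma decQ_dense x d : 0 < d -> exists k, Rabs (Q2R (decQ k) - x) <= d.
Proof.
  intros Hd. destruct (inv_INR_small d Hd) as (b & Hb).
  assert (HB : 0 < INR (S b)) by (apply lt_0_INR; lia).
  destruct (archimed (x * INR (S b))) as [H1 H2].
  destruct (decZ_surj (up (x * INR (S b)))) as (a & Ha).
  exists (npair a b). unfold decQ. rewrite unpair_npair, Ha. unfold Q2R. cbn [Qnum Qden].
  change (Z.pos (Pos.of_succ_nat b)) with (Z.of_nat (S b)). rewrite <- INR_IZR_INZ.
  set (u := IZR (up (x * INR (S b)))) in *.
  replace (u * / INR (S b) - x) with ((u - x * INR (S b)) * / INR (S b)) by (field; lra).
  assert (0 < / INR (S b)) by now apply Rinv_0_lt_compat.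
  rewrite Rabs_pos_eq; nra.
Qed.

Lemma coord_surj n (f : nat -> nat) : exists k, forall i, (i < n)%nat -> coord k i = f i.
Proof.
  revert f. induction n as [|n IH]; intros f; [exists 0%nat; intros; lia|].
  destruct (IH (fun i => f (S i))) as (k & Hk). exists (npair (f 0%nat) k).
  intros [|i] Hi; cbn [coord]; rewrite unpair_npair; simpl; auto. apply Hk. lia.
Qed.

Lemma Qvec_dense n z d : 0 < d -> exists k, dn n (proj1_sig (Qvec n k)) z < d.
Proof.
  intros Hd.
  assert (He : 0 < d / INR (S (S n))) by (apply Rdiv_lt_0_compat; auto; apply lt_0_INR; lia).
  assert (forall i, exists k, Rabs (Q2R (decQ k) - z i) <= d / INR (S (S n))) as H.
  { intros. now apply decQ_dense. }
  destruct (coord_surj n (fun i => proj1_sig (constructive_indefinite_description _ (H i)))) as (k & Hk).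
  exists k. eapply Rle_lt_trans.
  - apply dn_le_coord with (e := d / INR (S (S n))). intros i Hi. simpl.
    apply Nat.ltb_lt in Hi as Hi'. rewrite Hi', Hk by auto. apply (proj2_sig (constructive_indefinite_description _ (H i))).
  - rewrite !S_INR. pose proof (pos_INR n). rewrite !S_INR in He.
    replace d with ((INR n + 1 + 1) * (d / (INR n + 1 + 1))) at 2 by (field; lra). nra.
Qed.

Lemma ball_dense n (z : Rn n) d : 0 < d ->
  exists k, in_ball n k z /\ 0 < ball_radius k <= d.
Proof.
  intros Hd. destruct (inv_INR_small d Hd) as (b & Hb).
  assert (0 < / INR (S b)) as H0 by (apply Rinv_0_lt_compat, lt_0_INR; lia).
  destruct (Qvec_dense n (proj1_sig z) _ H0) as (c & Hc).
  (* [decZ] maps the code 2 to the numerator 1. *)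
  assert (ball_radius (npair c (npair 2 b)) = / INR (S b)) as E.
  { unfold ball_radius. rewrite Q2R_Qabs, unpair_npair. cbn [snd]. rewrite Q2R_decQ, unpair_npair.
    cbn [fst snd Nat.even Nat.div2]. simpl (INR 1). simpl (INR 0).
    rewrite Rabs_pos_eq; unfold Rdiv; lra. }
  exists (npair c (npair 2 b)). rewrite E. split; [|lra].
  unfold in_ball. rewrite E. unfold ball_center. rewrite unpair_npair. exact Hc.
Qed.

Definition zv : nat -> R := fun _ => 0.

Lemma dist_origin n (x : Rn n) : dist (origin n) x = dn n zv (proj1_sig x).
Proof.
  apply dn_ext. intros i Hi. simpl. now destruct (i <? n).
Qed.

Lemma dist_mkRn n (x : Rn n) f : dist x (mkRn n f) = dn n (proj1_sig x) f.
Proof.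
  apply dn_ext. intros i Hi. simpl. apply Nat.ltb_lt in Hi. now rewrite Hi.
Qed.

Lemma Rn_eq n (x y : Rn n) : (forall i, (i < n)%nat -> proj1_sig x i = proj1_sig y i) -> x = y.
Proof.
  intros H. destruct x as [x Hx], y as [y Hy]. simpl in H.
  assert (x = y) as ->.
  { apply functional_extensionality. intros i. destruct (Nat.lt_ge_cases i n); auto.
    now rewrite Hx, Hy. }
  f_equal. apply proof_irrelevance.
Qed.

Lemma dist_triangle n (x y z : Rn n) : dist x z <= dist x y + dist y z.
Proof. apply dn_triangle. Qed.

Lemma dist_sym n (x y : Rn n) : dist x y = dist y x.
Proof. apply dn_sym. Qed.

Lemma Qvec_0 n : Qvec n 0 = origin n.
Proof.
  apply Rn_eq. intros i Hi. simpl. apply Nat.ltb_lt in Hi. rewrite Hi.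
  assert (coord 0 i = 0%nat) as ->. { clear Hi. induction i; simpl in *; auto. }
  apply RMicromega.Q2R_0.
Qed.

Lemma names_Rn_bound n p x t : names_Rn n p x -> dist (Qvec n (p t)) x <= / 2 ^ t.
Proof.
  intros [H1 H2]. apply Rnot_lt_le. intros L.
  destruct (H2 (dist (Qvec n (p t)) x - / 2 ^ t)) as (N & HN); [lra|].
  specialize (HN (max N t) ltac:(lia)). specialize (H1 t (max N t) ltac:(lia)).
  pose proof (dist_triangle n (Qvec n (p t)) (Qvec n (p (max N t))) x). lra.
Qed.

(** Two errors of a quarter of 2^-i stay within the distance 2^-i permitted between entries. *)
Lemma names_Rn_intro n p x :
  (forall i, dist (Qvec n (p i)) x <= / 2 ^ (i + 2)) -> names_Rn n p x.
Proof.
  intros H.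
  assert (forall i, / 2 ^ (i + 2) = / 4 * / 2 ^ i) as E.
  { intros. rewrite pow_add. field. apply pow_nonzero. lra. }
  split.
  - intros i j Hij. pose proof (dist_triangle n (Qvec n (p i)) x (Qvec n (p j))) as T.
    rewrite (dist_sym n x) in T. pose proof (H i). pose proof (H j).
    pose proof (inv_pow2_anti i j Hij). rewrite E in *. pose proof (inv_pow2_pos i). lra.
  - intros eps He. destruct (inv_pow2_small eps He) as (N & HN). exists N. intros i Hi.
    pose proof (H i). pose proof (inv_pow2_anti N i Hi). rewrite E in *. pose proof (inv_pow2_pos i). lra.
Qed.

(** * The radial homeomorphism of the open unit ball *)

Definition psi (n : nat) (z : nat -> R) : nat -> R := fun i => z i * / (1 - sumsq n zv z).

Lemma norm_psi n z : dn n zv z < 1 -> dn n zv (psi n z) = dn n zv z / (1 - dn n zv z ^ 2).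
Proof.
  intros H. pose proof (dn_ge0 n zv z).
  rewrite (dn_ext n zv (psi n z) (fun i => / (1 - sumsq n zv z) * zv i)
     (fun i => / (1 - sumsq n zv z) * z i)).
  - rewrite dn_scale, <- dn_sq. rewrite Rabs_pos_eq; [unfold Rdiv; ring|].
    left. apply Rinv_0_lt_compat. nra.
  - intros. unfold psi, zv. ring.
Qed.

Lemma norm_psi_mono n z w : dn n zv z <= dn n zv w -> dn n zv w < 1 ->
  dn n zv (psi n z) <= dn n zv (psi n w).
Proof.
  intros H Hw. rewrite !norm_psi by lra.
  pose proof (dn_ge0 n zv z). set (s := dn n zv z) in *. set (t := dn n zv w) in *.
  apply Rmult_le_reg_r with ((1 - s ^ 2) * (1 - t ^ 2)); [apply Rmult_lt_0_compat; nra|].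
  replace (s / (1 - s ^ 2) * ((1 - s ^ 2) * (1 - t ^ 2))) with (s * (1 - t ^ 2)) by (field; nra).
  replace (t / (1 - t ^ 2) * ((1 - s ^ 2) * (1 - t ^ 2))) with (t * (1 - s ^ 2)) by (field; nra).
  (* After cross-multiplication the difference of the two sides is (t - s)(1 + st). *)
  assert (0 <= s * t) by nra. nra.
Qed.

Lemma psi_surj n u : exists z, dn n zv z < 1 /\ forall i, psi n z i = u i.
Proof.
  (* The preimage is sought as s u, which requires s = 1 - s^2 U^2. This is the positive root,
     written so that U = 0 needs no separate case; then (sU)^2 = 1 - s < 1. *)
  set (U := dn n zv u). set (w := sqrt (1 + 4 * U ^ 2)). set (s := 2 / (1 + w)).
  assert (Hw : w ^ 2 = 1 + 4 * U ^ 2) by (apply pow2_sqrt; nra).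
  assert (Hw0 : 0 <= w) by apply sqrt_pos.
  assert (Hs : 0 < s) by (apply Rdiv_lt_0_compat; lra).
  assert (Es : 1 - s ^ 2 * U ^ 2 = s).
  { assert (s * (1 + w) = 2) as E by (unfold s; field; lra).
    replace (U ^ 2) with ((w ^ 2 - 1) / 4) by (rewrite Hw; field).
    replace (s ^ 2 * ((w ^ 2 - 1) / 4)) with ((s * (1 + w)) * (s * (1 + w) - 2 * s) / 4) by field.
    rewrite E. field. }
  assert (En : dn n zv (fun i => s * u i) = s * U).
  { rewrite (dn_ext n zv _ (fun i => s * zv i) (fun i => s * u i)).
    - rewrite dn_scale, Rabs_pos_eq by lra. reflexivity.
    - intros. unfold zv. ring. }
  exists (fun i => s * u i). split.
  - rewrite En. pose proof (dn_ge0 n zv u). fold U in H. nra.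
  - intros i. unfold psi. rewrite <- dn_sq, En, Rpow_mult_distr, Es. field. lra.
Qed.

Definition lip (M : nat) : R := 3 * INR (S M) ^ 2.

(** Write psi(z) = a z and psi(w) = b w, so that psi(z) - psi(w) = a (z - w) + (a - b) w with a, b
    <= m = M + 1. The first term is at most m^2 |z - w|. Since a - b = ab (|z|^2 - |w|^2), the
    second is at most 2 m^2 |z - w|; together they give the factor 3. *)
Lemma psi_lip n M z w :
  dn n zv z <= 1 - / INR (S M) -> dn n zv w <= 1 - / INR (S M) ->
  dn n (psi n z) (psi n w) <= lip M * dn n z w.
Proof.
  intros Hz Hw. unfold lip. set (m := INR (S M)) in *.
  assert (Hm : 1 <= m) by (unfold m; rewrite S_INR; pose proof (pos_INR M); lra).
  set (a := / (1 - sumsq n zv z)). set (b := / (1 - sumsq n zv w)).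
  pose proof (dn_ge0 n zv z) as Pz. pose proof (dn_ge0 n zv w) as Pw.
  pose proof (dn_ge0 n z w) as Pd.
  assert (Hm' : 0 < / m) by (apply Rinv_0_lt_compat; lra).
  assert (Aux : forall s, 0 <= s -> s <= 1 - / m -> / m <= 1 - s ^ 2) by (intros; nra).
  assert (Ha : 0 < a <= m).
  { unfold a. rewrite <- dn_sq. specialize (Aux _ Pz Hz). split.
    - apply Rinv_0_lt_compat. lra.
    - rewrite <- (Rinv_inv m). apply Rinv_le_contravar; lra. }
  assert (Hb : 0 < b <= m).
  { unfold b. rewrite <- dn_sq. specialize (Aux _ Pw Hw). split.
    - apply Rinv_0_lt_compat. lra.
    - rewrite <- (Rinv_inv m). apply Rinv_le_contravar; lra. }
  assert (Eab : a - b = a * b * ((dn n zv z - dn n zv w) * (dn n zv z + dn n zv w))).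
  { unfold a, b. rewrite <- !dn_sq. pose proof (Aux _ Pz Hz). pose proof (Aux _ Pw Hw).
    field. split; lra. }
  assert (Dzw : Rabs (dn n zv z - dn n zv w) <= dn n z w).
  { pose proof (dn_triangle n zv z w). pose proof (dn_triangle n zv w z).
    rewrite (dn_sym n w z) in *. apply Rabs_le. lra. }
  eapply Rle_trans; [apply (dn_triangle n _ (fun i => a * w i))|].
  assert (E1 : dn n (psi n z) (fun i => a * w i) = a * dn n z w).
  { rewrite (dn_ext n _ _ (fun i => a * z i) (fun i => a * w i)).
    - rewrite dn_scale, Rabs_pos_eq by lra. reflexivity.
    - intros. unfold psi. fold a. ring. }
  assert (E2 : dn n (fun i => a * w i) (psi n w) = Rabs (a - b) * dn n zv w).
  { rewrite <- dn_scale, dn_sym. apply dn_ext. intros. unfold psi. fold b. unfold zv. ring. }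
  rewrite E1, E2, Eab, !Rabs_mult, (Rabs_pos_eq a), (Rabs_pos_eq b), (Rabs_pos_eq (_ + _)) by lra.
  set (d := dn n z w) in *. set (e := Rabs _) in *.
  assert (0 <= e) by apply Rabs_pos.
  assert (e * (dn n zv z + dn n zv w) * dn n zv w <= d * 2).
  { assert ((dn n zv z + dn n zv w) * dn n zv w <= 2) by nra.
    assert (0 <= (dn n zv z + dn n zv w) * dn n zv w) by nra.
    rewrite Rmult_assoc. apply Rmult_le_compat; auto. }
  assert (a * b <= m * m) by (apply Rmult_le_compat; lra).
  assert (a * d <= m ^ 2 * d) by (apply Rmult_le_compat_r; nra).
  assert (a * b * (e * (dn n zv z + dn n zv w)) * dn n zv w <= m * m * (d * 2)).
  { rewrite (Rmult_assoc (a * b)). apply Rmult_le_compat; auto; [nra|].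
    apply Rmult_le_pos; auto. apply Rmult_le_pos; auto. lra. }
  nra.
Qed.

(** * Forgetting the bound *)

Lemma reindex_functional (tau : nat -> nat) :
  cp (fun v => tau (v 0%nat)) ->
  exists h, computable_nat h /\ forall p, assoc_apply h p (fun i => p (tau i)).
Proof.
  intros Ht.
  destruct (staged_functional (fun _ _ => true) (fun p _ i => p (tau i)) (fun i => S (tau i)))
    as (h & Hh & H); auto.
  - apply cpb_true.
  - apply cp_cseq; [apply cp_var|]. apply (cp_app1 tau); auto using cp_var.
  - now apply cp_S.
  - intros p m M i L. unfold trunc. destruct (Nat.ltb_spec (tau i) m); auto; lia.
  - exists h. split; auto. intros p. destruct (H p) as (q & M & _ & Hq & E); [now exists 0%nat|].
    replace (fun i => p (tau i)) with q; auto. now apply functional_extensionality.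
Qed.

Lemma evens_join p r : evens (join p r) = p.
Proof.
  apply functional_extensionality. intros i. unfold evens, join.
  now rewrite Nat.even_mul, Nat.div2_double.
Qed.

Lemma even_succ_double i : Nat.even (2 * i + 1) = false.
Proof. rewrite Nat.add_1_r, Nat.even_succ, Nat.odd_mul. reflexivity. Qed.

Lemma div2_double_succ i : Nat.div2 (2 * i + 1) = i.
Proof. now rewrite Nat.add_1_r, Nat.div2_succ_double. Qed.

Lemma odds_join p r : odds (join p r) = r.
Proof.
  apply functional_extensionality. intros i. unfold odds, join.
  now rewrite even_succ_double, div2_double_succ.
Qed.

Lemma drop_bound_functional :
  exists h, computable_nat h /\ forall p, exists q, assoc_apply h p q /\
    evens q = evens p /\ odds q = btail (odds p).
Proof.
  (* The bound sits at index 1, so the odd positions move by two and the even ones stay. *)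
  destruct (reindex_functional (fun i => if Nat.even i then i else (i + 2)%nat)) as (h & Hh & H).
  { apply cp_if; [apply cpb_even|..]; try apply cp_add; auto using cp_var, cp_const. }
  exists h. split; auto. intros p. eexists. split; [apply H|].
  split; apply functional_extensionality; intros i; unfold evens, odds, btail.
  - now rewrite Nat.even_mul.
  - rewrite even_succ_double. f_equal. lia.
Qed.

Lemma compact_reduces_strong nm n :
  strong_weihrauch_le (ProjProblem (with_bound nm) n) (ProjProblem nm n).
Proof.
  destruct drop_bound_functional as (hK & HK & K).
  destruct (reindex_functional (fun i => i)) as (hH & HH & H). { apply cp_var. }
  exists hH, hK. repeat split; auto. intros G HG p x [Hx [HA HB]] Hd.
  destruct (K p) as (q & Hq & E1 & E2). exists q. split; auto.
  destruct (HG q x) as (r & Hr & y & Hy & Hv); auto.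
  { split; [now rewrite E1|now rewrite E2]. }
  exists r. split; auto. exists r. split; [apply (H r)|]. exists y. auto.
Qed.

Lemma compact_reduces nm n :
  weihrauch_le (ProjProblem (with_bound nm) n) (ProjProblem nm n).
Proof.
  destruct drop_bound_functional as (hK & HK & K).
  destruct (reindex_functional (fun i => (2 * i + 1)%nat)) as (hH & HH & H).
  { apply cp_add; [apply cp_mul|]; auto using cp_const, cp_var. }
  exists hH, hK. repeat split; auto. intros G HG p x [Hx [HA HB]] Hd.
  destruct (K p) as (q & Hq & E1 & E2). exists q. split; auto.
  destruct (HG q x) as (r & Hr & y & Hy & Hv); auto.
  { split; [now rewrite E1|now rewrite E2]. }
  exists r. split; auto. exists r. split.
  { rewrite <- (odds_join p r) at 2. apply (H (join p r)). }
  exists y. auto.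
Qed.

(** * Cutting off by a sphere *)

(** The implication holds vacuously on the sphere, and membership in [A] matters only in the open
    ball. *)
Definition shell {n} (A : Rn n -> Prop) (N : nat) (y : Rn n) : Prop :=
  dist (origin n) y <= INR N /\ (dist (origin n) y < INR N -> A y).

(** This test and the next two are formal relations: rational comparisons of centres and radii that
    imply the corresponding relations between balls. The [_small] lemmas are the partial converses:
    every sufficiently small ball around a suitable point passes. *)
Definition inside n k' k : bool :=
  rleb (dist (ball_center n k') (ball_center n k)) (ball_radius k - ball_radius k').
Definition within n k N : bool :=
  rleb (dist (origin n) (ball_center n k)) (INR N - ball_radius k).
Definition beyond n k N : bool :=
  rleb (INR N + ball_radius k) (dist (origin n) (ball_center n k)).

Lemma crv_origin n : crv (fun _ => proj1_sig (origin n)).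
Proof. intros i. simpl. destruct (i <? n)%nat; apply (cr_INR_const 0). Qed.

Lemma cpb_inside n a b : cp a -> cp b -> cpb (fun v => inside n (a v) (b v)).
Proof.
  intros Ha Hb. apply (cpb_dn_le n (fun v => proj1_sig (ball_center n (a v)))
    (fun v => proj1_sig (ball_center n (b v)))); auto using crv_center, cr_sub, cr_radius.
Qed.

Lemma cpb_within n a b : cp a -> cp b -> cpb (fun v => within n (a v) (b v)).
Proof.
  intros Ha Hb. apply (cpb_dn_le n (fun v => proj1_sig (origin n))
    (fun v => proj1_sig (ball_center n (a v))));
    auto using crv_center, crv_origin, cr_sub, cr_radius, cr_INR.
Qed.

Lemma cpb_beyond n a b : cp a -> cp b -> cpb (fun v => beyond n (a v) (b v)).
Proof.
  intros Ha Hb. apply (cpb_dn_ge n (fun v => proj1_sig (origin n))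
    (fun v => proj1_sig (ball_center n (a v))));
    auto using crv_center, crv_origin, cr_add, cr_radius, cr_INR.
Qed.

Lemma inside_in_ball n k' k y : inside n k' k = true -> in_ball n k' y -> in_ball n k y.
Proof.
  unfold inside, in_ball. rewrite rleb_true. intros H1 H2.
  pose proof (dist_triangle n (ball_center n k) (ball_center n k') y) as T.
  rewrite (dist_sym n (ball_center n k) (ball_center n k')) in T. lra.
Qed.

Lemma within_lt n k N y : within n k N = true -> in_ball n k y -> dist (origin n) y < INR N.
Proof.
  unfold within, in_ball. rewrite rleb_true. intros H1 H2.
  pose proof (dist_triangle n (origin n) (ball_center n k) y) as T. lra.
Qed.

Lemma beyond_gt n k N y : beyond n k N = true -> in_ball n k y -> INR N < dist (origin n) y.
Proof.
  unfold beyond, in_ball. rewrite rleb_true. intros H1 H2.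
  pose proof (dist_triangle n (origin n) y (ball_center n k)) as T.
  rewrite (dist_sym n y) in T. lra.
Qed.

Lemma inside_small n k' k y : in_ball n k y -> in_ball n k' y ->
  2 * ball_radius k' <= ball_radius k - dist (ball_center n k) y -> inside n k' k = true.
Proof.
  unfold inside, in_ball. rewrite rleb_true. intros H1 H2 H3.
  pose proof (dist_triangle n (ball_center n k') y (ball_center n k)) as T.
  rewrite (dist_sym n y) in T. lra.
Qed.

Lemma within_small n k N y : in_ball n k y ->
  2 * ball_radius k <= INR N - dist (origin n) y -> within n k N = true.
Proof.
  unfold within, in_ball. rewrite rleb_true. intros H2 H3.
  pose proof (dist_triangle n (origin n) y (ball_center n k)) as T.
  rewrite (dist_sym n y) in T. lra.
Qed.

Lemma beyond_small n k N y : in_ball n k y ->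
  2 * ball_radius k <= dist (origin n) y - INR N -> beyond n k N = true.
Proof.
  unfold beyond, in_ball. rewrite rleb_true. intros H2 H3.
  pose proof (dist_triangle n (origin n) (ball_center n k) y) as T. lra.
Qed.

Lemma ball_radius_ge0 k : 0 <= ball_radius k.
Proof. unfold ball_radius. rewrite Q2R_Qabs. apply Rabs_pos. Qed.

(** Failure of both tests says exactly that |N - s| is less than the radius, where s is the norm of
    the centre. Scaling the centre by N/s reaches the sphere at distance |N - s|; for s = 0 any
    direction will do, and the first unit vector is taken. Thus it is decidable whether a ball meets
    the sphere. *)
Lemma ball_meets_sphere n k N : (1 <= n)%nat -> (0 < N)%nat ->
  beyond n k N = false -> within n k N = false ->
  exists y, dist (origin n) y = INR N /\ in_ball n k y.
Proof.
  intros Hn HN. unfold beyond, within. rewrite !rleb_false. intros H1 H2.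
  apply lt_0_INR in HN. unfold in_ball. set (c := ball_center n k) in *.
  set (s := dist (origin n) c) in *.
  assert (Hs : 0 <= s) by apply dn_ge0.
  destruct (Req_dec s 0) as [Z|Z].
  - exists (mkRn n (fun i => if (i =? 0)%nat then INR N else 0)).
    assert (E : dist (origin n) (mkRn n (fun i => if (i =? 0)%nat then INR N else 0)) = INR N).
    { rewrite dist_mkRn.
      transitivity (Rabs (INR N) * 1); [|rewrite Rabs_pos_eq; lra].
      rewrite (dn_ext n _ _ (fun i => INR N * zv i) (fun i => INR N * if (i =? 0)%nat then 1 else 0)).
      - rewrite dn_scale. f_equal. destruct n as [|n]; [lia|]. clear. unfold dn.
        transitivity (sqrt 1); [|apply sqrt_1]. f_equal. induction n as [|n IH]; cbn [sumsq].
        + unfold zv. simpl. ring.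
        + cbn [sumsq] in IH. rewrite IH. unfold zv. simpl. ring.
      - intros i Hi. unfold zv. simpl. apply Nat.ltb_lt in Hi. rewrite Hi.
        destruct (i =? 0)%nat; ring. }
    split; [exact E|].
    pose proof (dist_triangle n c (origin n) (mkRn n (fun i => if (i =? 0)%nat then INR N else 0))) as T.
    rewrite (dist_sym n c (origin n)) in T. fold s in T. lra.
  - exists (mkRn n (fun i => INR N / s * proj1_sig c i)).
    assert (0 < INR N / s) by (apply Rdiv_lt_0_compat; lra).
    assert (Es : dn n zv (proj1_sig c) = s) by (unfold s; now rewrite dist_origin).
    split.
    + rewrite dist_mkRn.
      rewrite (dn_ext n _ _ (fun i => INR N / s * zv i) (fun i => INR N / s * proj1_sig c i)).
      * rewrite dn_scale, Rabs_pos_eq, Es by lra. field. auto.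
      * intros i Hi. simpl. apply Nat.ltb_lt in Hi. rewrite Hi. unfold zv. ring.
    + rewrite dist_mkRn.
      rewrite (dn_ext n _ _ (fun i => (INR N / s - 1) * zv i) (fun i => (INR N / s - 1) * proj1_sig c i)).
      2: { intros. unfold zv. ring. }
      rewrite dn_scale, Es. rewrite <- (Rabs_pos_eq s) at 2 by lra. rewrite <- Rabs_mult.
      replace ((INR N / s - 1) * s) with (INR N - s) by (field; auto).
      apply Rabs_def1; lra.
Qed.

Lemma not_shell n (A : Rn n -> Prop) N y :
  ~ shell A N y <-> INR N < dist (origin n) y \/ (dist (origin n) y < INR N /\ ~ A y).
Proof.
  unfold shell. split.
  - intros H. destruct (Rle_dec (dist (origin n) y) (INR N)); [right|left; lra].
    destruct (Rlt_dec (dist (origin n) y) (INR N)); [|exfalso; apply H; split; [auto|lra]].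
    split; auto.
  - intros [H|[H H']] [H1 H2]; [lra|auto].
Qed.

Lemma shell_closed n (A : Rn n -> Prop) N : closed_set A -> closed_set (shell A N).
Proof.
  intros HA x Hx. apply not_shell in Hx as [H|[H Hx]].
  - exists (dist (origin n) x - INR N). split; [lra|]. intros y Hy. apply not_shell. left.
    pose proof (dist_triangle n (origin n) y x) as T. rewrite (dist_sym n y x) in T. lra.
  - destruct (HA x Hx) as (e & He & HE).
    exists (Rmin e (INR N - dist (origin n) x)). split; [apply Rmin_pos; lra|].
    intros y Hy. apply not_shell. right. split.
    + pose proof (dist_triangle n (origin n) x y). pose proof (Rmin_r e (INR N - dist (origin n) x)). lra.
    + apply HE. pose proof (Rmin_l e (INR N - dist (origin n) x)). lra.
Qed.

Lemma shell_bounded n (A : Rn n -> Prop) N : bounded_by (shell A N) N.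
Proof. intros x [H _]. exact H. Qed.

(** Shared by [negname] and [pullname], which differ only inside the sphere. Points outside it are
    covered because small balls around them pass [beyond]. *)
Lemma names_neg_shell n q (A : Rn n -> Prop) N :
  (forall i k, q i = S k ->
     beyond n k N = true \/ forall z, in_ball n k z -> dist (origin n) z < INR N /\ ~ A z) ->
  (forall k, beyond n k N = true -> exists i, q i = S k) ->
  (forall z, dist (origin n) z < INR N -> ~ A z -> exists i k, q i = S k /\ in_ball n k z) ->
  names_neg n q (shell A N).
Proof.
  intros H1 H2 H3 z. rewrite not_shell. split.
  - intros [H|[H H']]; [|now apply H3].
    destruct (ball_dense n z ((dist (origin n) z - INR N) / 2)) as (k & Hk & Hr); [lra|].
    destruct (H2 k) as (i & Hi). { apply (beyond_small n k N z); auto. lra. }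
    now exists i, k.
  - intros (i & k & Hi & Hk). destruct (H1 i k Hi) as [B|B].
    + left. now apply (beyond_gt n k).
    + right. now apply B.
Qed.

(** A ball listed in [p] cannot be passed on, since it may meet the sphere. It is replaced by the
    smaller balls formally contained both in it and in the ball of radius [N]; [j] pairs such a ball
    with a position of [p]. *)
Definition negname n (p : baire) N j : nat :=
  if (beyond n (fst (unpair j)) N ||
      (negb (p (snd (unpair j)) =? 0) && inside n (fst (unpair j)) (pred (p (snd (unpair j))))
       && within n (fst (unpair j)) N))%bool%nat
  then S (fst (unpair j)) else 0.

(** The inclusion is reversed here: a ball is listed when it contains a ball of [p] lying within
    radius [N], or when it meets the sphere. *)
Definition posname n (p : baire) N j : nat :=
  if ((negb (beyond n (fst (unpair j)) N) && negb (within n (fst (unpair j)) N)) ||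
      (negb (p (snd (unpair j)) =? 0) && inside n (pred (p (snd (unpair j)))) (fst (unpair j))
       && within n (pred (p (snd (unpair j)))) N))%bool%nat
  then S (fst (unpair j)) else 0.

Lemma negname_correct n p (A : Rn n -> Prop) N :
  names_neg n p A -> names_neg n (negname n p N) (shell A N).
Proof.
  intros HA. apply names_neg_shell.
  - intros j k. unfold negname. destruct (unpair j) as [a b]. cbn [fst snd].
    destruct (beyond n a N) eqn:B; cbn [orb].
    { intros E. injection E as <-. now left. }
    destruct (p b) as [|k'] eqn:E; cbn [Nat.eqb negb andb pred]; [discriminate|].
    destruct (inside n a k') eqn:I; cbn [andb]; [|discriminate].
    destruct (within n a N) eqn:W; [|discriminate].
    intros X. injection X as <-. right. intros z Hz. split; [now apply (within_lt n a)|].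
    apply HA. exists b, k'. split; auto. now apply (inside_in_ball n a).
  - intros k B. exists (npair k 0). unfold negname. rewrite unpair_npair. cbn [fst snd].
    now rewrite B.
  - intros z Hz HnA. apply HA in HnA as (b & k' & E & Hk').
    assert (Hr := Hk'). unfold in_ball in Hr.
    destruct (ball_dense n z (Rmin ((INR N - dist (origin n) z) / 2)
      ((ball_radius k' - dist (ball_center n k') z) / 2))) as (a & Ha & R0 & R1).
    { apply Rmin_pos; lra. }
    exists (npair a b), a. split; auto. unfold negname. rewrite unpair_npair. cbn [fst snd].
    rewrite E. cbn [Nat.eqb negb andb pred].
    rewrite (inside_small n a k' z), (within_small n a N z); auto; [now rewrite Bool.orb_true_r| |].
    + eapply Rle_trans; [apply Rmult_le_compat_l; [lra|eapply Rle_trans; [exact R1|apply Rmin_l]]|]. lra.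
    + eapply Rle_trans; [apply Rmult_le_compat_l; [lra|eapply Rle_trans; [exact R1|apply Rmin_r]]|]. lra.
Qed.

Lemma posname_correct n p (A : Rn n -> Prop) N : (1 <= n)%nat -> (0 < N)%nat ->
  names_pos n p A -> names_pos n (posname n p N) (shell A N).
Proof.
  intros Hn HN [HC HA]. split; [now apply shell_closed|]. intros a. split.
  - intros (y & [Hy1 Hy2] & Hb).
    destruct (Rlt_dec (dist (origin n) y) (INR N)) as [L|L].
    + specialize (Hy2 L). assert (Hr := Hb). unfold in_ball in Hr.
      destruct (ball_dense n y (Rmin ((INR N - dist (origin n) y) / 2)
        ((ball_radius a - dist (ball_center n a) y) / 2))) as (k' & Hk' & R0 & R1).
      { apply Rmin_pos; lra. }
      destruct (proj1 (HA k')) as (b & E); [now exists y|].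
      exists (npair a b). unfold posname. rewrite unpair_npair. cbn [fst snd].
      rewrite E. cbn [Nat.eqb negb andb pred].
      rewrite (inside_small n k' a y), (within_small n k' N y); auto; [now rewrite Bool.orb_true_r| |].
      * eapply Rle_trans; [apply Rmult_le_compat_l; [lra|eapply Rle_trans; [exact R1|apply Rmin_l]]|]. lra.
      * eapply Rle_trans; [apply Rmult_le_compat_l; [lra|eapply Rle_trans; [exact R1|apply Rmin_r]]|]. lra.
    + exists (npair a 0). unfold posname. rewrite unpair_npair. cbn [fst snd].
      destruct (beyond n a N) eqn:B. { pose proof (beyond_gt n a N y B Hb). lra. }
      destruct (within n a N) eqn:W. { pose proof (within_lt n a N y W Hb). lra. }
      reflexivity.
  - intros (j & Hj). revert Hj. unfold posname. destruct (unpair j) as [a' b]. cbn [fst snd].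
    destruct (_ || _)%bool eqn:E; [|discriminate]. intros X. injection X as ->.
    apply Bool.orb_prop in E as [E|E].
    + apply andb_prop in E as [B W]. apply Bool.negb_true_iff in B, W.
      destruct (ball_meets_sphere n a N Hn HN B W) as (y & Hy & Hb).
      exists y. split; auto. split; lra.
    + apply andb_prop in E as [E W]. apply andb_prop in E as [E I].
      destruct (p b) as [|k'] eqn:Ep; [discriminate|]. cbn [pred] in *.
      destruct (proj2 (HA k')) as (y & Hy & Hb); [now exists b|].
      exists y. split; [|now apply (inside_in_ball n k')].
      pose proof (within_lt n k' N y W Hb). split; auto. lra.
Qed.

Lemma cp_negname n (P : (nat -> nat) -> baire) N j :
  (forall a, cp a -> cp (fun v => P v (a v))) -> cp N -> cp j ->
  cp (fun v => negname n (P v) (N v) (j v)).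
Proof.
  intros HP HN Hj. unfold negname.
  pose proof (HP _ (cp_snd _ Hj)).
  apply cp_if; auto using cp_S, cp_fst, cp_zero.
  apply cpb_orb; [|apply cpb_andb; [apply cpb_andb|]];
    auto using cpb_beyond, cpb_inside, cpb_within, cp_fst, cp_pred, cpb_negb, cpb_eqb, cp_zero.
Qed.

Lemma cp_posname n (P : (nat -> nat) -> baire) N j :
  (forall a, cp a -> cp (fun v => P v (a v))) -> cp N -> cp j ->
  cp (fun v => posname n (P v) (N v) (j v)).
Proof.
  intros HP HN Hj. unfold posname.
  pose proof (HP _ (cp_snd _ Hj)).
  apply cp_if; auto using cp_S, cp_fst, cp_zero.
  apply cpb_orb; [|apply cpb_andb; [apply cpb_andb|]];
    auto using cpb_andb, cpb_beyond, cpb_inside, cpb_within, cp_fst, cp_pred, cpb_negb, cpb_eqb, cp_zero.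
Qed.

Lemma proj_point_intro n (x : Rn n) (A : Rn n -> Prop) y :
  A y -> (forall a, A a -> dist x y <= dist x a) -> is_proj_point x A y.
Proof. intros H1 H2. split; [|split]; auto. Qed.

Lemma proj_shell n (x a0 : Rn n) (A : Rn n -> Prop) N y :
  A a0 -> dist (origin n) x + dist x a0 < INR N ->
  is_proj_point x (shell A N) y -> is_proj_point x A y.
Proof.
  intros Ha0 HN ([Hy1 Hy2] & Hmin & _).
  assert (Far : forall z, INR N <= dist (origin n) z -> dist x a0 < dist x z).
  { intros z Hz. pose proof (dist_triangle n (origin n) x z). lra. }
  assert (H0 : dist x y <= dist x a0).
  { apply Hmin. pose proof (dist_triangle n (origin n) x a0). split; auto. lra. }
  apply proj_point_intro.
  - apply Hy2. apply Rnot_le_lt. intros L. specialize (Far y L). lra.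
  - intros a Ha. destruct (Rle_dec (INR N) (dist (origin n) a)) as [L|L].
    + specialize (Far a L). lra.
    + apply Hmin. split; auto. lra.
Qed.

Lemma bex_ext m f g : (forall i, (i < m)%nat -> f i = g i) -> bex m f = bex m g.
Proof.
  intros H. apply bool_iff. rewrite !bex_true.
  split; intros (i & Hi & E); exists i; split; auto; [rewrite <- H|rewrite H]; auto.
Qed.

Lemma trunc_lt p m j : (j < m)%nat -> trunc p m j = p j.
Proof. intros H. unfold trunc. destruct (Nat.ltb_spec j m); auto; lia. Qed.

(* The radius is [4 M + 3] for the first stage [M] at which a listed ball is seen whose centre and radius
   are at most [M], and so is the first approximation of [x]. Then [|x| <= M + 1], and some
   point [a] of [A] has [|a| < 2 M], so that [|x| + d(x, a) < 4 M + 3]. *)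
Lemma shell_reduction n nm (pi : nat -> nat) (F : baire -> nat -> nat -> nat) :
  cp (fun v => pi (v 0%nat)) ->
  cp (fun v => F (cseq (v 0%nat)) (v 1%nat) (v 2%nat)) ->
  (forall p m N j, (4 * j + 4 <= m)%nat -> F (trunc p m) N j = F p N j) ->
  (forall p A, nm n (odds p) A -> names_pos n (fun b => p (pi b)) A) ->
  (forall p A N, (0 < N)%nat -> nm n (odds p) A -> nm n (F p N) (shell A N)) ->
  strong_weihrauch_le (ProjProblem nm n) (ProjProblem (with_bound nm) n).
Proof.
  intros Hpi HF Floc Hpos HFc.
  (* The guards [0 <? M] and [pi i <? M] confine the test to positions below [M], so truncating [p]
     at or beyond [M] does not change it. *)
  set (cond := fun (p : baire) (M : nat) => ((0 <? M)%nat &&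
     (bex M (fun i => ((pi i <? M)%nat && (negb (p (pi i) =? 0)%nat &&
        (rleb (dist (origin n) (ball_center n (pred (p (pi i))))) (INR M) &&
         rleb (ball_radius (pred (p (pi i)))) (INR M)))))
     && rleb (dist (origin n) (Qvec n (p 0%nat))) (INR M)))%bool).
  set (out := fun (p : baire) (M i : nat) => if Nat.even i then p i else
     if (Nat.div2 i =? 0)%nat then (4 * M + 3)%nat else F p (4 * M + 3)%nat (pred (Nat.div2 i))).
  (* The deepest read comes from two nested odd halves, at position [4 * b + 3] with [b <= i]. *)
  destruct (staged_functional cond out (fun i => 4 * i + 4)%nat) as (hK & HK & K).
  - apply cpb_andb; [apply cpb_ltb; auto using cp_zero, cp_var|].
    apply cpb_andb.
    + apply (cpb_bex (fun i v => ((pi i <? v 1%nat)%nat && (negb (cseq (v 0%nat) (pi i) =? 0)%nat &&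
        (rleb (dist (origin n) (ball_center n (pred (cseq (v 0%nat) (pi i))))) (INR (v 1%nat)) &&
         rleb (ball_radius (pred (cseq (v 0%nat) (pi i)))) (INR (v 1%nat))))))%bool%nat); [apply cp_var|].
      pose proof (cp_cseq _ _ (cp_var 1%nat) Hpi) as C.
      repeat apply cpb_andb.
      * apply cpb_ltb; auto using cp_var.
      * apply cpb_negb, cpb_eqb; auto using cp_zero.
      * apply (cpb_dn_le n (fun v => proj1_sig (origin n))
          (fun v => proj1_sig (ball_center n (pred (cseq (v 1%nat) (pi (v 0%nat)))))));
          auto using crv_origin, crv_center, cp_pred, cr_INR, cp_var.
      * apply cpb_rleb; auto using cr_radius, cp_pred, cr_INR, cp_var.
    + apply (cpb_dn_le n (fun v => proj1_sig (origin n))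
          (fun v => proj1_sig (Qvec n (cseq (v 0%nat) 0%nat))));
          auto using crv_origin, crv_Qvec, cp_cseq, cp_zero, cr_INR, cp_var.
  - assert (HM : cp (fun v => 4 * v 1 + 3)%nat).
    { apply cp_add; [apply cp_mul|]; auto using cp_const, cp_var. }
    apply cp_if; [apply cpb_even, cp_var|apply cp_cseq; apply cp_var|].
    apply cp_if; [apply cpb_eqb; auto using cp_div2, cp_var, cp_zero|exact HM|].
    apply (cp_subst _ (fun v i => match i with 0%nat => v 0%nat | 1%nat => (4 * v 1%nat + 3)%nat
      | _ => pred (Nat.div2 (v 2%nat)) end) HF).
    intros [|[|i]]; auto using cp_var, cp_pred, cp_div2.
  - apply cp_add; [apply cp_mul|]; auto using cp_const, cp_var.
  - intros p m M L. unfold cond. destruct (Nat.ltb_spec 0 M) as [L0|L0]; [|reflexivity].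
    cbn [andb]. f_equal; [|rewrite trunc_lt by lia; reflexivity].
    apply bex_ext. intros i Hi. destruct (Nat.ltb_spec (pi i) M); [|reflexivity].
    rewrite trunc_lt by lia. reflexivity.
  - intros p m M i L. unfold out. rewrite trunc_lt by lia.
    rewrite Floc; [reflexivity|]. pose proof (Nat.div2_decr i (S i) ltac:(lia)). lia.
  - destruct (reindex_functional (fun i => i)) as (hH & HH & H). { apply cp_var. }
    exists hH, hK. repeat split; auto. intros G HG p [x A] [Hx HA] [a Ha]. cbn [fst snd] in *.
    destruct (K p) as (q & M & HM & Hq & Eq).
    { destruct (ball_dense n a 1) as (k & Hk & Hr); [lra|].
      destruct (proj2 (Hpos p A HA) k) as [HA1 _].
      destruct HA1 as (i & Ei); [now exists a|].
      destruct (INR_unbounded (Rmax (dist (origin n) (ball_center n k))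
        (Rmax (ball_radius k) (dist (origin n) (Qvec n (p 0%nat)))))) as (M & HM).
      (* Besides dominating the three magnitudes, the stage must exceed [i] and [pi i] for the
         guards in [cond]. *)
      exists (S (M + i + pi i)).
      assert (HM' : INR M <= INR (S (M + i + pi i))) by (apply le_INR; lia).
      pose proof (Rmax_l (dist (origin n) (ball_center n k))
        (Rmax (ball_radius k) (dist (origin n) (Qvec n (p 0%nat))))).
      pose proof (Rmax_r (dist (origin n) (ball_center n k))
        (Rmax (ball_radius k) (dist (origin n) (Qvec n (p 0%nat))))).
      pose proof (Rmax_l (ball_radius k) (dist (origin n) (Qvec n (p 0%nat)))).
      pose proof (Rmax_r (ball_radius k) (dist (origin n) (Qvec n (p 0%nat)))).
      unfold cond. rewrite !Bool.andb_true_iff, bex_true, rleb_true. repeat split.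
      - exists i. split; [lia|]. cbn [fst snd] in *. rewrite Ei. cbn [pred Nat.eqb negb andb].
        rewrite !Bool.andb_true_iff, !rleb_true. split; [apply Nat.ltb_lt; lia|]. lra.
      - lra. }
    exists q. split; auto.
    assert (E1 : evens q = evens p).
    { apply functional_extensionality. intros i. unfold evens. rewrite Eq. unfold out.
      now rewrite Nat.even_mul. }
    assert (E2 : forall j, odds q j = if (j =? 0)%nat then (4 * M + 3)%nat else F p (4 * M + 3)%nat (pred j)).
    { intros j. unfold odds. rewrite Eq. unfold out. now rewrite even_succ_double, div2_double_succ. }
    assert (E3 : btail (odds q) = F p (4 * M + 3)%nat).
    { apply functional_extensionality. intros j. unfold btail. now rewrite E2. }
    assert (Hfar : exists a0, A a0 /\ dist (origin n) x + dist x a0 < INR (4 * M + 3)).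
    { unfold cond in HM. rewrite !Bool.andb_true_iff, bex_true, rleb_true in HM.
      destruct HM as (HM0 & (i & Hi & HM1) & HM2).
      rewrite !Bool.andb_true_iff, !rleb_true in HM1. destruct HM1 as (_ & N0 & B1 & B2).
      destruct (p (pi i)) as [|k] eqn:Ek; [discriminate|]. cbn [pred] in *.
      destruct (proj2 (proj2 (Hpos p A HA) k)) as (a0 & Ha0 & Hb). { now exists i. }
      exists a0. split; auto. unfold in_ball in Hb.
      pose proof (names_Rn_bound n _ x 0 Hx) as X. unfold evens in X. simpl (2 * 0)%nat in X.
      rewrite pow_O, Rinv_1 in X.
      pose proof (dist_triangle n (origin n) (Qvec n (p 0%nat)) x).
      pose proof (dist_triangle n x (origin n) a0) as T. rewrite (dist_sym n x (origin n)) in T.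
      pose proof (dist_triangle n (origin n) (ball_center n k) a0).
      rewrite plus_INR, mult_INR. simpl (INR 4). simpl (INR 3). lra. }
    destruct Hfar as (a0 & Ha0 & Hfar).
    assert (Hne : shell A (4 * M + 3) a0).
    { pose proof (dist_triangle n (origin n) x a0). split; auto. lra. }
    destruct (HG q (x, shell A (4 * M + 3))) as (r & Hr & y & Hy & Hv); cbn.
    { split; [now rewrite E1|]. split.
      - rewrite E3. apply HFc; auto. lia.
      - rewrite E2. apply shell_bounded. }
    { now exists a0. }
    exists r. split; auto. exists r. split; [apply (H r)|]. exists y. split; auto.
    cbn in Hv |- *. apply (proj_shell n x a0 A (4 * M + 3) y); auto.
Qed.

Lemma Proj_pos_le_ProjK_pos n : (1 <= n)%nat -> strong_weihrauch_le (Proj_pos n) (ProjK_pos n).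
Proof.
  intros Hn. apply (shell_reduction n names_pos (fun b => 2 * b + 1)%nat
    (fun p => posname n (odds p))).
  - apply cp_add; [apply cp_mul|]; auto using cp_const, cp_var.
  - apply (cp_posname n (fun v => odds (cseq (v 0%nat)))); auto using cp_var.
    intros a Ha. apply cp_cseq; [apply cp_var|]. apply cp_add; [apply cp_mul|]; auto using cp_const.
  - intros p m N j Hm. unfold posname, odds. pose proof (unpair_le j).
    rewrite trunc_lt by lia. reflexivity.
  - auto.
  - intros. now apply posname_correct.
Qed.

Lemma Proj_tot_le_ProjK_tot n : (1 <= n)%nat -> strong_weihrauch_le (Proj_tot n) (ProjK_tot n).
Proof.
  intros Hn. apply (shell_reduction n names_tot (fun b => 2 * (2 * b + 1) + 1)%nat
    (fun p N j => if Nat.even j then negname n (evens (odds p)) N (Nat.div2 j)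
                  else posname n (odds (odds p)) N (Nat.div2 j))).
  - repeat (apply cp_add || apply cp_mul); auto using cp_const, cp_var.
  - apply cp_if; [apply cpb_even, cp_var| |].
    + apply (cp_negname n (fun v => evens (odds (cseq (v 0%nat))))); auto using cp_var, cp_div2.
      intros a Ha. apply cp_cseq; [apply cp_var|].
      repeat (apply cp_add || apply cp_mul); auto using cp_const.
    + apply (cp_posname n (fun v => odds (odds (cseq (v 0%nat))))); auto using cp_var, cp_div2.
      intros a Ha. apply cp_cseq; [apply cp_var|].
      repeat (apply cp_add || apply cp_mul); auto using cp_const.
  - intros p m N j Hm. unfold posname, negname, evens, odds. pose proof (unpair_le (Nat.div2 j)).
    pose proof (Nat.div2_decr j j ltac:(lia)).
    rewrite !trunc_lt by lia. reflexivity.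
  - intros p A [_ H]. exact H.
  - intros p A N HN [H1 H2]. split.
    + replace (evens _) with (negname n (evens (odds p)) N); [now apply negname_correct|].
      apply functional_extensionality. intros j. unfold evens at 2.
      now rewrite Nat.even_mul, Nat.div2_double.
    + replace (odds _) with (posname n (odds (odds p)) N); [now apply posname_correct|].
      apply functional_extensionality. intros j. unfold odds at 3.
      now rewrite even_succ_double, div2_double_succ.
Qed.

(** * Compactification by a radial homeomorphism *)

Definition shift n (x : Rn n) (z : nat -> R) : Rn n := mkRn n (fun i => proj1_sig x i + psi n z i).

(** Meaningful only in the open unit ball; elsewhere psi takes arbitrary values, which [shell] with
    radius 1 does not consult. *)
Definition pulled n (x : Rn n) (A : Rn n -> Prop) (z : Rn n) : Prop := A (shift n x (proj1_sig z)).

Lemma dist_shift n (x : Rn n) z : dist x (shift n x z) = dn n zv (psi n z).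
Proof.
  unfold shift. rewrite dist_mkRn, dn_sym, (dn_sym n zv). apply dn_ext.
  intros. unfold zv. ring.
Qed.

Lemma shift_surj n (x a : Rn n) : exists z : Rn n,
  dist (origin n) z < 1 /\ shift n x (proj1_sig z) = a.
Proof.
  destruct (psi_surj n (fun i => proj1_sig a i - proj1_sig x i)) as (z & Hz & E).
  assert (Hd : forall y, dn n y (proj1_sig (mkRn n z)) = dn n y z).
  { intros y. apply dn_ext. intros i Hi. simpl. apply Nat.ltb_lt in Hi. now rewrite Hi. }
  exists (mkRn n z). split.
  - rewrite dist_origin. now rewrite Hd.
  - apply Rn_eq. intros i Hi. cbn [shift mkRn proj1_sig]. apply Nat.ltb_lt in Hi. rewrite Hi.
    transitivity (proj1_sig x i + psi n z i); [|rewrite E; ring].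
    f_equal. unfold psi. rewrite <- !dn_sq, Hd. cbn [mkRn proj1_sig]. now rewrite Hi.
Qed.

(** Every point of [A] has a preimage strictly inside the unit ball, so minimality keeps [w] off the
    sphere. As d(x, x + psi(z)) increases with |z|, least norm turns into least distance from x. *)
Lemma proj_pulled n (x : Rn n) (A : Rn n -> Prop) w : (exists a, A a) ->
  is_proj_point (origin n) (shell (pulled n x A) 1) w ->
  dist (origin n) w < 1 /\ is_proj_point x A (shift n x (proj1_sig w)).
Proof.
  intros (a & Ha) ([Hw1 Hw2] & Hmin & _).
  assert (H : forall b, A b -> exists z : Rn n, dist (origin n) w <= dist (origin n) z < 1 /\
      shift n x (proj1_sig z) = b).
  { intros b Hb. destruct (shift_surj n x b) as (z & Hz & E). exists z. repeat split; auto.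
    apply Hmin. split; [simpl; lra|]. intros _. unfold pulled. now rewrite E. }
  assert (Hlt : dist (origin n) w < 1) by (destruct (H a Ha) as (z & Hz & _); lra).
  split; auto. apply proj_point_intro.
  - now apply Hw2.
  - intros b Hb. destruct (H b Hb) as (z & Hz & <-). rewrite !dist_shift.
    rewrite !dist_origin in Hz. apply norm_psi_mono; lra.
Qed.

(** [j] codes a ball [a], a listed ball [k], a precision [t] and a margin [M]; the ball [a] is listed if
    it is disjoint from the closed unit ball, or if the Lipschitz constant [lip M] certifies
    that [x + psi] maps it into [k]. *)
Definition pullname n (p : baire) (j : nat) : nat :=
  let a := fst (unpair j) in
  let b := fst (unpair (snd (unpair j))) in
  let t := fst (unpair (snd (unpair (snd (unpair j))))) in
  let M := snd (unpair (snd (unpair (snd (unpair j))))) in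
  let k := pred (p (2 * b + 1)%nat) in
  if (beyond n a 1 ||
     (negb (p (2 * b + 1) =? 0)%nat &&
      (rleb (dist (origin n) (ball_center n a)) (INR 1 - / INR (S M) - ball_radius a) &&
       rleb (dn n (fun i => proj1_sig (Qvec n (p (2 * t)%nat)) i + psi n (proj1_sig (ball_center n a)) i)
                  (proj1_sig (ball_center n k)))
            (ball_radius k - / 2 ^ t - lip M * ball_radius a))))%bool
  then S a else 0.

Lemma crv_psi n X : crv X -> crv (fun v => psi n (X v)).
Proof.
  intros H i. unfold psi. apply cr_mul; auto. apply cr_inv, cr_sub; [apply (cr_INR_const 1)|].
  apply (cr_sumsq n (fun _ => zv)); auto. intros j. apply (cr_INR_const 0).
Qed.

Lemma crv_add X Y : crv X -> crv Y -> crv (fun v i => X v i + Y v i).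
Proof. intros HX HY i. apply cr_add; auto. Qed.

Lemma cr_lip a : cp a -> cr (fun v => lip (a v)).
Proof.
  intros H. apply cr_mul; [apply cr_ext with (fun _ => INR 3); [intros; simpl; lra|apply cr_INR_const]|].
  apply cr_pow. now apply (cr_INR (fun v => S (a v))), cp_S.
Qed.

Lemma cp_pullname n (P : (nat -> nat) -> baire) j :
  (forall a, cp a -> cp (fun v => P v (a v))) -> cp j -> cp (fun v => pullname n (P v) (j v)).
Proof.
  intros HP Hj. unfold pullname. cbv zeta.
  assert (Ha := cp_fst _ Hj). assert (H1 := cp_snd _ Hj).
  assert (Hb := cp_fst _ H1). assert (H2 := cp_snd _ H1).
  assert (Ht := cp_fst _ H2). assert (HM := cp_snd _ H2).
  assert (Hk : cp (fun v => P v (2 * fst (unpair (snd (unpair (j v)))) + 1)%nat)).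
  { apply HP. apply cp_add; [apply cp_mul|]; auto using cp_const. }
  assert (Hq : cp (fun v => P v (2 * fst (unpair (snd (unpair (snd (unpair (j v)))))))%nat)).
  { apply HP. apply cp_mul; auto using cp_const. }
  apply cp_if; auto using cp_S, cp_zero.
  apply cpb_orb; [apply (cpb_beyond n _ (fun _ => 1%nat)); auto using cp_const|].
  apply cpb_andb; [apply cpb_negb, cpb_eqb; auto using cp_zero|]. apply cpb_andb.
  - apply (cpb_dn_le n (fun v => proj1_sig (origin n)) (fun v => proj1_sig (ball_center n (fst (unpair (j v))))));
      auto using crv_origin, crv_center.
    apply cr_sub; [apply cr_sub|]; auto using cr_INR_const, cr_radius.
    apply cr_inv. now apply (cr_INR (fun v => S _)), cp_S.
  - apply (cpb_dn_le n
      (fun v i => proj1_sig (Qvec n (P v (2 * fst (unpair (snd (unpair (snd (unpair (j v)))))))%nat)) i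
                  + psi n (proj1_sig (ball_center n (fst (unpair (j v))))) i)
      (fun v => proj1_sig (ball_center n (pred (P v (2 * fst (unpair (snd (unpair (j v)))) + 1)%nat))))).
    + apply (crv_add (fun v => proj1_sig (Qvec n (P v _))) (fun v => psi n (proj1_sig (ball_center n _))));
        auto using crv_Qvec, crv_psi, crv_center.
    + apply crv_center. now apply cp_pred.
    + apply cr_sub; [apply cr_sub|]; auto using cr_radius, cp_pred, cr_inv_pow2, cr_mul, cr_lip.
Qed.

Lemma pullname_correct n p x (A : Rn n -> Prop) :
  names_Rn n (evens p) x -> names_neg n (odds p) A ->
  names_neg n (pullname n p) (shell (pulled n x A) 1).
Proof.
  intros Hx HA. apply names_neg_shell.
  - intros j k. unfold pullname. cbv zeta.
    set (a := fst _). set (b := fst _). set (t := fst (unpair (snd (unpair (snd _))))). set (M := snd _).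
    destruct (beyond n a 1) eqn:B; cbn [orb].
    { intros E. injection E as <-. now left. }
    destruct (p (2 * b + 1)%nat) as [|k'] eqn:E; cbn [Nat.eqb negb andb pred]; [discriminate|].
    destruct (_ && _)%bool eqn:C; [|discriminate]. intros X. injection X as <-. right.
    apply andb_prop in C as [C1 C2]. rewrite rleb_true in C1, C2. intros z Hz.
    assert (Hz' := Hz). unfold in_ball in Hz'.
    assert (0 < / INR (S M)) by (apply Rinv_0_lt_compat, lt_0_INR; lia).
    pose proof (ball_radius_ge0 a).
    pose proof (dist_triangle n (origin n) (ball_center n a) z) as T.
    change (INR 1) with 1 in *. split; [lra|].
    apply HA. exists b, k'. split; auto. unfold in_ball.
    rewrite dist_sym. unfold shift.
    pose proof (names_Rn_bound n _ x t Hx) as Hq. unfold evens in Hq.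
    rewrite dist_origin in C1. rewrite dist_origin in T.
    assert (L : dn n (psi n (proj1_sig (ball_center n a))) (psi n (proj1_sig z))
              <= lip M * dist (ball_center n a) z).
    { apply psi_lip; rewrite <- ?dist_origin in *; lra. }
    assert (lip M * dist (ball_center n a) z < lip M * ball_radius a).
    { apply Rmult_lt_compat_l; auto. unfold lip. apply Rmult_lt_0_compat; [lra|].
      apply pow_lt, lt_0_INR. lia. }
    rewrite dist_sym, dist_mkRn.
    eapply Rle_lt_trans; [apply (dn_triangle n _ (fun i => proj1_sig (Qvec n (p (2 * t)%nat)) i
       + psi n (proj1_sig (ball_center n a)) i))|].
    rewrite dn_sym in C2.
    pose proof (dn_add n (proj1_sig (Qvec n (p (2 * t)%nat))) (proj1_sig x)
      (psi n (proj1_sig (ball_center n a))) (psi n (proj1_sig z))) as D.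
    change (dn n (proj1_sig (Qvec n (p (2 * t)%nat))) (proj1_sig x)) with (dist (Qvec n (p (2 * t)%nat)) x) in D.
    lra.
  - intros k B. exists (npair k 0). unfold pullname. rewrite unpair_npair. cbn [fst snd].
    now rewrite B.
  - intros z Hz HnA. change (INR 1) with 1 in Hz.
    apply HA in HnA as (b & k' & E & Hk'). unfold in_ball in Hk'.
    set (y := shift n x (proj1_sig z)) in *. set (d := ball_radius k' - dist (ball_center n k') y).
    assert (Hd : 0 < d) by (unfold d; lra).
    (* The margin is fixed before the ball, whose radius depends on [lip M]. Half of 1 - |z| pays
       for the margin, the other half for twice the radius. *)
    destruct (inv_INR_small ((1 - dist (origin n) z) / 2)) as (M & HM); [lra|].
    (* The errors 2^-t and [lip M] times the radius each count twice, once as a safety term in the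
       test and once in estimating the tested distance; hence a quarter of the slack [d] for
       each. *)
    destruct (inv_pow2_small (d / 4)) as (t & Ht); [lra|].
    assert (HL : 0 < lip M).
    { unfold lip. apply Rmult_lt_0_compat; [lra|]. apply pow_lt, lt_0_INR. lia. }
    destruct (ball_dense n z (Rmin ((1 - dist (origin n) z) / 4) (d / 4 / lip M))) as (a & Ha & R0 & R1).
    { apply Rmin_pos; [lra|]. apply Rdiv_lt_0_compat; lra. }
    assert (R2 := Rle_trans _ _ _ R1 (Rmin_l _ _)). assert (R3 := Rle_trans _ _ _ R1 (Rmin_r _ _)).
    assert (R4 : lip M * ball_radius a <= d / 4).
    { apply (Rmult_le_compat_l (lip M)) in R3; [|lra].
      replace (lip M * (d / 4 / lip M)) with (d / 4) in R3 by (field; lra). exact R3. }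
    assert (Ha' := Ha). unfold in_ball in Ha'.
    exists (npair a (npair b (npair t M))), a. split; auto.
    unfold pullname. do 3 (rewrite unpair_npair; cbn [fst snd]).
    unfold odds in E. rewrite E. cbn [Nat.eqb negb andb pred].
    pose proof (dist_triangle n (origin n) z (ball_center n a)) as T.
    rewrite (dist_sym n z) in T.
    assert (C1 : dist (origin n) (ball_center n a) <= 1 - / INR (S M) - ball_radius a) by lra.
    change (INR 1) with 1. rewrite (proj2 (rleb_true _ _) C1).
    match goal with |- context [rleb ?u ?v] => assert (C2 : rleb u v = true) end.
    2: { rewrite C2. now rewrite Bool.orb_true_r. }
    apply rleb_true.
    pose proof (names_Rn_bound n _ x t Hx) as Hq. unfold evens in Hq.
    assert (L : dn n (psi n (proj1_sig (ball_center n a))) (psi n (proj1_sig z))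
              <= lip M * dist (ball_center n a) z).
    { apply psi_lip; rewrite <- dist_origin; lra. }
    assert (lip M * dist (ball_center n a) z <= lip M * ball_radius a).
    { apply Rmult_le_compat_l; lra. }
    eapply Rle_trans; [apply (dn_triangle n _ (fun i => proj1_sig x i + psi n (proj1_sig z) i))|].
    pose proof (dn_add n (proj1_sig (Qvec n (p (2 * t)%nat))) (proj1_sig x)
      (psi n (proj1_sig (ball_center n a))) (psi n (proj1_sig z))) as D.
    change (dn n (proj1_sig (Qvec n (p (2 * t)%nat))) (proj1_sig x)) with (dist (Qvec n (p (2 * t)%nat)) x) in D.
    assert (Ey : dn n (fun i => proj1_sig x i + psi n (proj1_sig z) i) (proj1_sig (ball_center n k'))
       = dist (ball_center n k') y).
    { unfold y, shift. rewrite dist_mkRn. apply dn_sym. }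
    rewrite Ey. unfold d in *. lra.
Qed.

Lemma pull_functional n : exists h, computable_nat h /\
  forall p x (A : Rn n -> Prop), names_Rn n (evens p) x -> names_neg n (odds p) A ->
  exists q, assoc_apply h p q /\ names_Rn n (evens q) (origin n) /\
    with_bound names_neg n (odds q) (shell (pulled n x A) 1).
Proof.
  (* The point to be projected becomes the origin, named by the constant 0 ([Qvec_0]), and the bound
     is 1; x survives only inside [pullname]. *)
  set (out := fun (p : baire) (M i : nat) => if Nat.even i then 0%nat else
     if (Nat.div2 i =? 0)%nat then 1%nat else pullname n p (pred (Nat.div2 i))).
  destruct (staged_functional (fun _ _ => true) out (fun i => 4 * i + 4)%nat) as (h & Hh & H); auto.
  - apply cpb_true.
  - apply cp_if; [apply cpb_even, cp_var|apply cp_zero|].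
    apply cp_if; [apply cpb_eqb; auto using cp_div2, cp_var, cp_zero|apply cp_const|].
    apply (cp_pullname n (fun v => cseq (v 0%nat))); auto using cp_cseq, cp_var, cp_pred, cp_div2.
  - apply cp_add; [apply cp_mul|]; auto using cp_const, cp_var.
  - intros p m M i L. unfold out, pullname.
    pose proof (Nat.div2_decr i i ltac:(lia)).
    pose proof (unpair_le (pred (Nat.div2 i))).
    pose proof (unpair_le (snd (unpair (pred (Nat.div2 i))))).
    pose proof (unpair_le (snd (unpair (snd (unpair (pred (Nat.div2 i))))))).
    rewrite !trunc_lt by lia. reflexivity.
  - exists h. split; auto. intros p x A Hx HA.
    destruct (H p) as (q & M & _ & Hq & E); [now exists 0%nat|].
    exists q. split; auto. split.
    + apply names_Rn_intro. intros i. unfold evens. rewrite E. unfold out. rewrite Nat.even_mul. cbn [orb Nat.even].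
      rewrite Qvec_0. change (dist (origin n) (origin n)) with (dn n (proj1_sig (origin n)) (proj1_sig (origin n))).
      rewrite dn_self. pose proof (inv_pow2_pos (i + 2)). lra.
    + split.
      * replace (btail (odds q)) with (pullname n p); [now apply pullname_correct|].
        apply functional_extensionality. intros j. unfold btail, odds. rewrite E. unfold out.
        now rewrite even_succ_double, div2_double_succ.
      * unfold odds. rewrite E. apply shell_bounded.
Qed.

(** The name of [w] is read at odd positions, that of [x] at multiples of 4 (doubling the index, as
    the name of [x] is the even half of the original input). The margin [M] confines [w] to the region where
    [psi] is [lip M]-Lipschitz. *)
Definition shift_test n (s : baire) (m i k : nat) : bool :=
  bex m (fun M => bex m (fun j =>
    ((4 * j <? m)%nat && (2 * j + 1 <? m)%nat &&
     rleb (dist (origin n) (Qvec n (s (2 * j + 1)%nat))) (INR 1 - INR 2 * / INR (S M)) &&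
     rleb (/ 2 ^ j) (/ INR (S M)) &&
     rleb (dn n (proj1_sig (Qvec n k))
        (fun c => proj1_sig (Qvec n (s (4 * j)%nat)) c + psi n (proj1_sig (Qvec n (s (2 * j + 1)%nat))) c))
        (/ 2 ^ (i + 3)) &&
     rleb ((INR 1 + lip M) * / 2 ^ j) (/ 2 ^ (i + 3)))%bool)).

Lemma cpb_shift_test n : cpb (fun v => shift_test n (cseq (v 0%nat)) (v 1%nat) (v 2%nat) (v 3%nat)).
Proof.
  apply (cpb_bex (fun M v => bex (v 1%nat) (fun j =>
    ((4 * j <? v 1%nat)%nat && (2 * j + 1 <? v 1%nat)%nat &&
     rleb (dist (origin n) (Qvec n (cseq (v 0%nat) (2 * j + 1)%nat))) (INR 1 - INR 2 * / INR (S M)) &&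
     rleb (/ 2 ^ j) (/ INR (S M)) &&
     rleb (dn n (proj1_sig (Qvec n (v 3%nat)))
        (fun c => proj1_sig (Qvec n (cseq (v 0%nat) (4 * j)%nat)) c + psi n (proj1_sig (Qvec n (cseq (v 0%nat) (2 * j + 1)%nat))) c))
        (/ 2 ^ (v 2%nat + 3)) &&
     rleb ((INR 1 + lip M) * / 2 ^ j) (/ 2 ^ (v 2%nat + 3)))%bool))); [apply cp_var|].
  apply (cpb_bex (fun j v =>
    ((4 * j <? v 2%nat)%nat && (2 * j + 1 <? v 2%nat)%nat &&
     rleb (dist (origin n) (Qvec n (cseq (v 1%nat) (2 * j + 1)%nat))) (INR 1 - INR 2 * / INR (S (v 0%nat))) &&
     rleb (/ 2 ^ j) (/ INR (S (v 0%nat))) &&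
     rleb (dn n (proj1_sig (Qvec n (v 4%nat)))
        (fun c => proj1_sig (Qvec n (cseq (v 1%nat) (4 * j)%nat)) c + psi n (proj1_sig (Qvec n (cseq (v 1%nat) (2 * j + 1)%nat))) c))
        (/ 2 ^ (v 3%nat + 3)) &&
     rleb ((INR 1 + lip (v 0%nat)) * / 2 ^ j) (/ 2 ^ (v 3%nat + 3)))%bool)); [apply cp_var|].
  cbv beta.
  assert (H4 : cp (fun v => 4 * v 0%nat)%nat) by (apply cp_mul; auto using cp_const, cp_var).
  assert (H2 : cp (fun v => 2 * v 0%nat + 1)%nat) by (apply cp_add; [apply cp_mul|]; auto using cp_const, cp_var).
  assert (H3 : cp (fun v => v 4%nat + 3)%nat) by (apply cp_add; auto using cp_const, cp_var).
  assert (HS : cr (fun v => / INR (S (v 1%nat)))).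
  { apply cr_inv. apply (cr_INR (fun v => S (v 1%nat))), cp_S, cp_var. }
  repeat apply cpb_andb.
  - apply cpb_ltb; auto using cp_var.
  - apply cpb_ltb; auto using cp_var.
  - apply (cpb_dn_le n (fun _ => proj1_sig (origin n))
       (fun v => proj1_sig (Qvec n (cseq (v 2%nat) (2 * v 0%nat + 1)%nat))));
      auto using crv_origin, crv_Qvec, cp_cseq, cp_var, cr_sub, cr_mul, cr_INR_const.
  - apply cpb_rleb; auto using cr_inv_pow2, cp_var.
  - apply (cpb_dn_le n (fun v => proj1_sig (Qvec n (v 5%nat)))
       (fun v c => proj1_sig (Qvec n (cseq (v 2%nat) (4 * v 0%nat)%nat)) c
         + psi n (proj1_sig (Qvec n (cseq (v 2%nat) (2 * v 0%nat + 1)%nat))) c)).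
    + apply crv_Qvec, cp_var.
    + apply (crv_add (fun v => proj1_sig (Qvec n (cseq (v 2%nat) _)))
        (fun v => psi n (proj1_sig (Qvec n (cseq (v 2%nat) _)))));
        auto using crv_psi, crv_Qvec, cp_cseq, cp_var.
    + now apply (cr_inv_pow2 (fun v => v 4 + 3)%nat).
  - apply cpb_rleb; [|now apply (cr_inv_pow2 (fun v => v 4 + 3)%nat)].
    apply cr_mul; [apply cr_add|]; auto using cr_INR_const, cr_lip, cr_inv_pow2, cp_var.
Qed.

(** The continuity of psi at [w] depends on the distance of [w] from the sphere, which is positive
    but not bounded below in advance. The margin and the precision are therefore searched for
    together with each output, and every accepted candidate is accurate. *)
Lemma shift_functional n : exists h, computable_nat h /\
  forall p r (x w : Rn n), names_Rn n (evens p) x -> names_Rn n r w -> dist (origin n) w < 1 ->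
  exists s, assoc_apply h (join p r) s /\ names_Rn n s (shift n x (proj1_sig w)).
Proof.
  destruct (search_functional (shift_test n) (cpb_shift_test n)) as (h & Hh & H).
  exists h. split; auto. intros p r x w Hx Hw Hlt.
  assert (Ex : forall j, dist (Qvec n (join p r (4 * j)%nat)) x <= / 2 ^ j).
  { intros j. pose proof (names_Rn_bound n _ x j Hx) as B. rewrite <- (evens_join p r) in B.
    unfold evens in B. now replace (2 * (2 * j))%nat with (4 * j)%nat in B by lia. }
  assert (Ew : forall j, dist (Qvec n (join p r (2 * j + 1)%nat)) w <= / 2 ^ j).
  { intros j. pose proof (names_Rn_bound n _ w j Hw) as B. rewrite <- (odds_join p r) in B. exact B. }
  set (u := join p r) in *.
  destruct (H u) as (s & Hs & HT).
  - intros i.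
    (* Three margins must fit between |w| and 1: the test demands two, and the approximation of [w]
       may cost one. Demanding two lets [w] itself be placed within one margin when only its
       approximation is known. *)
    destruct (inv_INR_small ((1 - dist (origin n) w) / 3)) as (M & HM); [lra|].
    assert (HM0 : 0 < / INR (S M)) by (apply Rinv_0_lt_compat, lt_0_INR; lia).
    assert (HL : 0 < lip M).
    { unfold lip. apply Rmult_lt_0_compat; [lra|]. apply pow_lt, lt_0_INR. lia. }
    pose proof (inv_pow2_pos (i + 3)).
    destruct (inv_pow2_small (Rmin (/ INR (S M)) (/ 2 ^ (i + 3) / (1 + lip M)))) as (j & Hj).
    { apply Rmin_pos; [lra|]. apply Rdiv_lt_0_compat; lra. }
    assert (J1 := Rlt_le_trans _ _ _ Hj (Rmin_l _ _)). assert (J2 := Rlt_le_trans _ _ _ Hj (Rmin_r _ _)).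
    destruct (Qvec_dense n (fun c => proj1_sig (Qvec n (u (4 * j)%nat)) c
      + psi n (proj1_sig (Qvec n (u (2 * j + 1)%nat))) c) (/ 2 ^ (i + 3))) as (k & Hk); auto.
    exists (S (M + 4 * j + 1)), k. intros m Hm. unfold shift_test.
    apply bex_true. exists M. split; [lia|]. apply bex_true. exists j. split; [lia|].
    rewrite !trunc_lt by lia. rewrite !Bool.andb_true_iff, !rleb_true, !Nat.ltb_lt.
    repeat split; try lia; try lra.
    + pose proof (dist_triangle n (origin n) w (Qvec n (u (2 * j + 1)%nat))) as T.
      rewrite (dist_sym n w) in T. specialize (Ew j). simpl (INR 1). simpl (INR 2). lra.
    + apply (Rmult_lt_compat_l (1 + lip M)) in J2; [|lra].
      replace ((1 + lip M) * (/ 2 ^ (i + 3) / (1 + lip M))) with (/ 2 ^ (i + 3)) in J2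
        by (field; repeat split; try apply pow_nonzero; lra).
      simpl (INR 1). lra.
  - exists s. split; auto. apply names_Rn_intro. intros i. destruct (HT i) as (m & Hm).
    unfold shift_test in Hm. apply bex_true in Hm as (M & _ & Hm). apply bex_true in Hm as (j & _ & Hm).
    rewrite !Bool.andb_true_iff, !rleb_true, !Nat.ltb_lt in Hm.
    destruct Hm as (((((K1 & K2) & K3) & K4) & K5) & K6).
    rewrite !trunc_lt in * by lia. simpl (INR 1) in *. simpl (INR 2) in *.
    assert (HM0 : 0 < / INR (S M)) by (apply Rinv_0_lt_compat, lt_0_INR; lia).
    specialize (Ex j). specialize (Ew j).
    assert (L : dn n (psi n (proj1_sig (Qvec n (u (2 * j + 1)%nat)))) (psi n (proj1_sig w))
       <= lip M * dist (Qvec n (u (2 * j + 1)%nat)) w).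
    { pose proof (dist_triangle n (origin n) (Qvec n (u (2 * j + 1)%nat)) w).
      apply psi_lip; rewrite <- dist_origin; lra. }
    assert (HL : 0 < lip M).
    { unfold lip. apply Rmult_lt_0_compat; [lra|]. apply pow_lt, lt_0_INR. lia. }
    apply (Rmult_le_compat_l (lip M)) in Ew; [|lra].
    unfold shift. rewrite dist_mkRn.
    eapply Rle_trans; [eapply dn_triangle|].
    pose proof (dn_add n (proj1_sig (Qvec n (u (4 * j)%nat))) (proj1_sig x)
      (psi n (proj1_sig (Qvec n (u (2 * j + 1)%nat)))) (psi n (proj1_sig w))) as D.
    change (dn n (proj1_sig (Qvec n (u (4 * j)%nat))) (proj1_sig x)) with (dist (Qvec n (u (4 * j)%nat)) x) in D.
    eapply Rle_trans; [apply Rplus_le_compat; [exact K5|exact D]|].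
    (* One half of the admissible error is for rounding to the output, the other for the
       approximations of x and w. *)
    assert (E : / 2 ^ (i + 2) = 2 * / 2 ^ (i + 3)).
    { rewrite !pow_add. field. apply pow_nonzero. lra. }
    rewrite E. lra.
Qed.

(** The compact instance is centred at the origin, so rebuilding x + psi(w) from its answer requires
    the name of x in the original input. This is where the reduction uses the plain notion rather
    than the strong one. *)
Lemma Proj_neg_le_ProjK_neg n : weihrauch_le (Proj_neg n) (ProjK_neg n).
Proof.
  destruct (pull_functional n) as (hK & HK & K). destruct (shift_functional n) as (hH & HH & H).
  exists hH, hK. repeat split; auto. intros G HG p [x A] [Hx HA] [a Ha]. cbn [fst snd] in *.
  destruct (K p x A Hx HA) as (q & Hq & Q1 & Q2). exists q. split; auto.
  assert (Hne : exists z, shell (pulled n x A) 1 z).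
  { destruct (shift_surj n x a) as (z & Hz & E). exists z. split; [simpl; lra|].
    intros _. unfold pulled. now rewrite E. }
  destruct (HG q (origin n, shell (pulled n x A) 1)) as (r & Hr & w & Hw & Hv); [split; auto|exact Hne|].
  exists r. split; auto. destruct (proj_pulled n x A w) as [Hlt Hp]; [now exists a|exact Hv|].
  destruct (H p r x w Hx Hw Hlt) as (s & Hs & Hsn). exists s. split; auto.
  exists (shift n x (proj1_sig w)). split; auto.
Qed.

Theorem theorem4p6 : forall n : nat, (1 <= n)%nat ->
  weihrauch_eq (ProjK_neg n) (Proj_neg n) /\
  strong_weihrauch_eq (ProjK_pos n) (Proj_pos n) /\
  strong_weihrauch_eq (ProjK_tot n) (Proj_tot n).
Proof.
  intros n Hn. split; [|split]; split.
  - apply compact_reduces.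
  - apply Proj_neg_le_ProjK_neg.
  - apply compact_reduces_strong.
  - now apply Proj_pos_le_ProjK_pos.
  - apply compact_reduces_strong.
  - now apply Proj_tot_le_ProjK_tot.
Qed.
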